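(* Let $q=e^{2\pi\iota/N}$ with $N=2h+1$, $h\ge1$, let $\mathcal C=\mathrm{Rep}(u_q(\mathfrak{sl}_2))$ over $\mathbb C$ with its ribbon structure $\theta$, and let $A=\mathbb C[x]/(x^N)$ with the $u_q(\mathfrak{sl}_2)$-action making it an algebra in $\mathcal C$ determined by $K\cdot x=q^{-2}x$, $E\cdot x=1$, $F\cdot x=-q\,x^2$. Then $A$ is a haploid, commutative, exact algebra in $\mathcal C$ with $\theta_A=\mathrm{id}_A$ and $A^*\notin(\mathcal C_A^{\mathrm{loc}})'$.
   Context: $u_q(\mathfrak{sl}_2)$ is the Hopf algebra over $\mathbb C$ generated by $E,F,K$ with $K^N=1$, $E^N=F^N=0$, $KE=q^2EK$, $KF=q^{-2}FK$, $EF-FE=(K-K^{-1})/(q-q^{-1})$; $\Delta(K)=K\otimes K$, $\Delta(E)=E\otimes K+1\otimes E$, $\Delta(F)=F\otimes1+K^{-1}\otimes F$; $\varepsilon(K)=1$, $\varepsilon(E)=\varepsilon(F)=0$; $S(K)=K^{-1}$, $S(E)=-EK^{-1}$, $S(F)=-KF$. Its $R$-matrix is $$R=\frac1N\sum_{0\le p,s,r\le N-1}\frac{(q-q^{-1})^p}{[p]!}q^{\frac{p(p-1)}2+2p(s-r)-2sr}E^pK^s\otimes F^pK^r,$$ where $[p]!=\prod_{k=1}^p\frac{q^k-q^{-k}}{q-q^{-1}}$. $\mathrm{Rep}$ denotes finite-dimensional modules; writing $R=\sum_iR_i\otimes R^i$, the braiding is $c_{V,W}(v\otimes w)=\sum_iR^iw\otimes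 R_iv$. This is a non-degenerate braided finite tensor category with a ribbon structure $\theta$ given by the action of the ribbon element of $u_q(\mathfrak{sl}_2)$, i.e. the scalar multiple of $\sum_{0\le m,j\le N-1}\frac{(q-q^{-1})^m}{[m]!}(-1)^mq^{-\frac12m+mj+\frac12(j+1)^2}F^mE^mK^j$ (with $q^{1/2}$ the square root of $q$ that is a power of $q$) normalized so that $\theta_{\mathbf 1}=\mathrm{id}$. An algebra $(A,\mu,\eta)$ in $\mathcal C$ is commutative if $\mu c_{A,A}=\mu$, haploid if $\mathrm{Hom}_{\mathcal C}(\mathbf 1,A)\cong\mathbb C$, exact if $P\otimes M$ is projective in the category of right $A$-modules in $\mathcal C$ for all projective $P\in\mathcal C$ and all right $A$-modules $M$ in $\mathcal C$. $\mathcal C_A^{\mathrm{loc}}$ is the braided monoidal category (under $\otimes_A$, with left action $a_M^rc_{A,M}$ and the braiding induced by $c$) of right $A$-modules $(M,a_M^r)$ in $\mathcal C$ with $a_M^rc_{A,M}c_{M,A}=a_M^r$. $(\mathcal C_A^{\mathrm{loc}})'$ is its Müger center, i.e. the objects $X$ whose double braiding with every object of $\mathcal C_A^{\mathrm{loc}}$ is the identity. $A^*$ is the right $A$-module with action $(\mathrm{id}_{A^*}\otimes\mathrm{ev}_A)(\mu^*\otimes\mathrm{id}_A):A^*\otimes A\to A^*$. *)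

(* Defs.v *)
From HB Require Import structures.
From mathcomp Require Import all_boot all_order all_algebra.
From mathcomp Require Import reals trigo.
From mathcomp Require Import complex.

Set Implicit Arguments.
Unset Strict Implicit.
Unset Printing Implicit Defensive.

Import GRing.Theory.
Local Open Scope ring_scope.

Reserved Notation "v \ox w" (at level 40, left associativity).

Section Tensor.
Context {k : fieldType}.
Implicit Types U V W : vectType k.

(* V (x) W, as the coordinate matrices on the chosen bases of V and W;
   [tens_liftE] and [tens_ext] are its universal property. *)
Definition tens V W : vectType k := 'M[k]_(\dim {:V}, \dim {:W}).

Definition tensv V W (v : V) (w : W) : tens V W :=
  \matrix_(i, j) (coord (vbasis {:V}) i v * coord (vbasis {:W}) j w).

Local Notation "v \ox w" := (tensv v w) : ring_scope.

(* The linear map v (x) w |-> b v w, for bilinear b. *)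
Definition tens_lift V W U (b : V -> W -> U) : 'Hom(tens V W, U) :=
  linfun (fun t : tens V W =>
    \sum_i \sum_j t i j *: b (vbasis {:V})`_i (vbasis {:W})`_j).

Lemma tens_liftE V W U (b : V -> W -> U) :
    (forall w, linear (b ^~ w)) -> (forall v, linear (b v)) ->
  forall v w, tens_lift b (v \ox w) = b v w.
Proof.
move=> bl br v w.
have sl I (r : seq I) (c : I -> k) (x : I -> V) y :
    b (\sum_(i <- r) c i *: x i) y = \sum_(i <- r) c i *: b (x i) y.
  elim: r => [|i r IH]; last by rewrite !big_cons bl IH.
  by rewrite !big_nil; have := bl y (-1) 0 0; rewrite scaler0 add0r scaleN1r addNr.
have sr I (r : seq I) (c : I -> k) (x : I -> W) y :
    b y (\sum_(i <- r) c i *: x i) = \sum_(i <- r) c i *: b y (x i).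
  elim: r => [|i r IH]; last by rewrite !big_cons br IH.
  by rewrite !big_nil; have := br y (-1) 0 0; rewrite scaler0 add0r scaleN1r addNr.
pose f := fun t : tens V W =>
  \sum_i \sum_j t i j *: b (vbasis {:V})`_i (vbasis {:W})`_j.
have f_lin : linear f.
  move=> c s t; rewrite /f scaler_sumr -big_split; apply: eq_bigr => i _ /=.
  rewrite scaler_sumr -big_split; apply: eq_bigr => j _ /=.
  by rewrite !mxE scalerDl scalerA.
pose fL := GRing.isLinear.Build k _ _ _ f f_lin.
pose g : {linear tens V W -> U} := HB.pack f fL.
rewrite /tens_lift -/f (lfunE g) /= /f.
rewrite [in RHS](coord_vbasis (memvf v)) sl; apply: eq_bigr => i _.
rewrite [in RHS](coord_vbasis (memvf w)) sr scaler_sumr; apply: eq_bigr => j _.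
by rewrite mxE scalerA.
Qed.

Lemma tens_ext V W U (f g : 'Hom(tens V W, U)) :
  (forall v w, f (v \ox w) = g (v \ox w)) -> f = g.
Proof.
move=> fg; apply/lfunP => t.
suff -> : t = \sum_i \sum_j t i j *: ((vbasis {:V})`_i \ox (vbasis {:W})`_j).
  rewrite !linear_sum; apply: eq_bigr => i _.
  by rewrite !linear_sum; apply: eq_bigr => j _; rewrite !linearZ /= fg.
apply/matrixP => a b; rewrite summxE (bigD1 a) //= summxE (bigD1 b) //=.
rewrite !mxE !coord_free ?(basis_free (vbasisP _)) // !eqxx !mulr1.
rewrite big1 ?addr0 => [|j jb]; last first.
  rewrite !mxE !coord_free ?(basis_free (vbasisP _)) //.
  by rewrite (negPf jb) !mulr0.
rewrite big1 ?addr0 // => i ia; rewrite summxE big1 // => j _.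
rewrite !mxE !coord_free ?(basis_free (vbasisP _)) //.
by rewrite (negPf ia) mul0r mulr0.
Qed.

End Tensor.

Notation "v \ox w" := (tensv v w) : ring_scope.

Section Quotient.
Context {k : fieldType}.
Implicit Types V W : vectType k.

(* V / U, realised on the complement of U; [vquot_proj] is the projection
   along U. *)
Definition vquot V (U : {vspace V}) : vectType k := subvs_of (U^C)%VS.

Definition vquot_proj V (U : {vspace V}) : 'Hom(V, vquot U) :=
  linfun (fun v => vsproj (U^C)%VS (v - projv U v)).

(* The map V / U -> W / U' induced by f, when f U is contained in U'. *)
Definition vquot_map V W (U : {vspace V}) (U' : {vspace W}) (f : 'Hom(V, W)) :
    'Hom(vquot U, vquot U') :=
  (vquot_proj U' \o f \o linfun (@vsval _ _ (U^C)%VS))%VF.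

Lemma vquot_projE V (U : {vspace V}) v :
  vsval (vquot_proj U v) = v - projv U v.
Proof.
pose f v := vsproj (U^C)%VS (v - projv U v).
have f_lin : linear f.
  move=> c x y; rewrite /f -linearP; congr (vsproj _ _).
  by rewrite linearP scalerBr opprD addrACA.
pose fL := GRing.isLinear.Build k _ _ _ f f_lin.
pose g : {linear V -> vquot U} := HB.pack f fL.
by rewrite /vquot_proj (lfunE g) /= /f vsprojK // memv_projC.
Qed.

Lemma lker_vquot_proj V (U : {vspace V}) : lker (vquot_proj U) = U.
Proof.
apply/vspaceP => v; rewrite memv_ker -val_eqE /= vquot_projE subr_eq0.
by apply/eqP/idP => [->|/projv_id->//]; apply: memv_proj.
Qed.

Lemma vquot_projK V (U : {vspace V}) : cancel vsval (vquot_proj U).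
Proof.
move=> x; apply: val_inj; rewrite /= vquot_projE.
suff -> : projv U (vsval x) = 0 by rewrite subr0.
by apply/eqP; rewrite -memv_ker lker_proj subvsP.
Qed.

Lemma vquot_mapE V W (U : {vspace V}) (U' : {vspace W}) (f : 'Hom(V, W)) :
    (f @: U <= U')%VS ->
  (vquot_map U U' f \o vquot_proj U = vquot_proj U' \o f)%VF.
Proof.
move=> fU; apply/lfunP => v; rewrite !comp_lfunE /= lfunE /= vquot_projE.
rewrite !linearB /=; suff -> : vquot_proj U' (f (projv U v)) = 0 by rewrite subr0.
apply/eqP; rewrite -memv_ker lker_vquot_proj.
by apply: subvP fU _ _; apply: memv_img; apply: memv_proj.
Qed.

End Quotient.

Section SmallQuantumGroup.
Context {k : fieldType} (N : nat) (q : k).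

(* By the presentation of u_q(sl_2), a module is a vector space with three
   operators satisfying the defining relations. *)
Record uqops (V : vectType k) :=
  UqOps { opE : 'End(V); opF : 'End(V); opK : 'End(V) }.

Record uqdata := UqData { uq_space :> vectType k; uq_ops : uqops uq_space }.

Definition actE (V : uqdata) : 'End(V) := opE (uq_ops V).
Definition actF (V : uqdata) : 'End(V) := opF (uq_ops V).
Definition actK (V : uqdata) : 'End(V) := opK (uq_ops V).
Definition actKV (V : uqdata) : 'End(V) := (actK V)^-1%VF.

Record uq_module (V : uqdata) : Prop := UqModule {
  uq_KN : forall v, iter N (actK V) v = v;
  uq_EN : forall v, iter N (actE V) v = 0;
  uq_FN : forall v, iter N (actF V) v = 0;
  uq_KE : forall v, actK V (actE V v) = q ^+ 2 *: actE V (actK V v);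
  uq_KF : forall v, actK V (actF V v) = q ^- 2 *: actF V (actK V v);
  uq_EF : forall v, actE V (actF V v) - actF V (actE V v)
                    = (q - q^-1)^-1 *: (actK V v - actKV V v) }.

Definition uq_hom (V W : uqdata) (f : 'Hom(V, W)) : Prop :=
  [/\ forall v, f (actE V v) = actE W (f v),
      forall v, f (actF V v) = actF W (f v)
    & forall v, f (actK V v) = actK W (f v)].

(* The action through the counit: E, F |-> 0 and K |-> 1. *)
Definition uq_unit : uqdata := UqData (UqOps (0 : 'End(k^o)) 0 \1%VF).

(* Coproduct: E |-> E (x) K + 1 (x) E, F |-> F (x) 1 + K^-1 (x) F,
   K |-> K (x) K. *)
Definition uq_tens (V W : uqdata) : uqdata := @UqData (tens V W) (UqOps
  (tens_lift (fun (v : V) (w : W) => actE V v \ox actK W w + v \ox actE W w))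
  (tens_lift (fun (v : V) (w : W) => actF V v \ox w + actKV V v \ox actF W w))
  (tens_lift (fun (v : V) (w : W) => actK V v \ox actK W w))).

(* Left dual, (a f)(v) = f (S(a) v) with S(E) = - E K^-1, S(F) = - K F,
   S(K) = K^-1. *)
Definition uq_dual (V : uqdata) : uqdata := @UqData 'Hom(V, k^o) (UqOps
  (linfun (fun f : 'Hom(V, k^o) => - (f \o (actE V \o actKV V)))%VF)
  (linfun (fun f : 'Hom(V, k^o) => - (f \o (actK V \o actF V)))%VF)
  (linfun (fun f : 'Hom(V, k^o) => f \o actKV V)%VF)).

Definition qfact (p : nat) : k :=
  \prod_(1 <= i < p.+1) ((q ^+ i - q ^- i) / (q - q^-1)).

(* c (v (x) w) = sum_i R^i w (x) R_i v *)
Definition braid (V W : uqdata) : 'Hom(uq_tens V W, uq_tens W V) :=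
  tens_lift (fun (v : V) (w : W) => N%:R^-1 *:
    \sum_(p < N) \sum_(s < N) \sum_(r < N)
      ((q - q^-1) ^+ p / qfact p
       * q ^ ((p * p.-1)./2%:Z + 2 * p%:Z * (s%:Z - r%:Z) - 2 * s%:Z * r%:Z))
      *: (iter p (actF W) (iter r (actK W) w)
          \ox iter p (actE V) (iter s (actK V) v))).

(* For N odd and q ^+ N = 1, the square root of q that is a power of q. *)
Definition qsqrt : k := q ^+ (N.+1)./2.

Definition ribbon_sum (V : uqdata) (v : V) : V :=
  \sum_(m < N) \sum_(j < N)
    ((q - q^-1) ^+ m / qfact m * (-1) ^+ m
     * qsqrt ^ (- m%:Z + 2 * m%:Z * j%:Z + (j%:Z + 1) ^+ 2))
    *: iter m (actF V) (iter m (actE V) (iter j (actK V) v)).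

(* The factor normalises the twist of the unit object to 1. *)
Definition twist (V : uqdata) : 'End(V) :=
  linfun (fun v : V => (@ribbon_sum uq_unit 1)^-1 *: ribbon_sum v).

(* In the category of modules, an epimorphism is a surjective morphism. *)
Definition surj (V W : vectType k) (f : 'Hom(V, W)) : Prop :=
  forall w, exists v, f v = w.

Definition uq_projective (P : uqdata) : Prop :=
  uq_module P /\
  forall (X Y : uqdata) (g : 'Hom(X, Y)) (f : 'Hom(P, Y)),
    uq_module X -> uq_module Y ->
    uq_hom (V := X) (W := Y) g -> surj g -> uq_hom (V := P) (W := Y) f ->
  exists2 f' : 'Hom(P, X), uq_hom (V := P) (W := X) f' & (g \o f')%VF = f.

Record algdata := AlgData {
  alg_obj :> uqdata;
  amul : 'Hom(uq_tens alg_obj alg_obj, alg_obj);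
  aunit : 'Hom(uq_unit, alg_obj) }.

Record uq_algebra (A : algdata) : Prop := UqAlgebra {
  alg_module : uq_module A;
  amul_hom : uq_hom (V := uq_tens A A) (W := A) (amul A);
  aunit_hom : uq_hom (V := uq_unit) (W := A) (aunit A);
  amulA : forall a b c : A,
    amul A (a \ox amul A (b \ox c)) = amul A (amul A (a \ox b) \ox c);
  amul1l : forall a : A, amul A (aunit A 1 \ox a) = a;
  amul1r : forall a : A, amul A (a \ox aunit A 1) = a }.

Definition commutative_alg (A : algdata) : Prop :=
  (amul A \o braid A A)%VF = amul A.

(* Hom(1, A) is isomorphic to k. *)
Definition haploid_alg (A : algdata) : Prop :=
  exists2 i : 'Hom(k^o, 'Hom(uq_unit, A)), injective i
    & forall f, uq_hom (V := uq_unit) (W := A) f <-> exists c, f = i c.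

Record rmoddata (A : algdata) := RmodData {
  rmod_obj :> uqdata;
  ract : 'Hom(uq_tens rmod_obj A, rmod_obj) }.

Record rmodule (A : algdata) (M : rmoddata A) : Prop := Rmodule {
  rmod_module : uq_module M;
  ract_hom : uq_hom (V := uq_tens M A) (W := M) (ract M);
  ractA : forall (m : M) (a b : A),
    ract M (ract M (m \ox a) \ox b) = ract M (m \ox amul A (a \ox b));
  ract1 : forall m : M, ract M (m \ox aunit A 1) = m }.

Definition rmod_hom (A : algdata) (M L : rmoddata A) (f : 'Hom(M, L)) : Prop :=
  uq_hom (V := M) (W := L) f /\
  forall (m : M) (a : A), f (ract M (m \ox a)) = ract L (f m \ox a).

Definition rmod_projective (A : algdata) (P : rmoddata A) : Prop :=
  rmodule P /\
  forall (X Y : rmoddata A) (g : 'Hom(X, Y)) (f : 'Hom(P, Y)),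
    rmodule X -> rmodule Y ->
    rmod_hom (M := X) (L := Y) g -> surj g -> rmod_hom (M := P) (L := Y) f ->
  exists2 f' : 'Hom(P, X), rmod_hom (M := P) (L := X) f' & (g \o f')%VF = f.

Definition tens_rmod (A : algdata) (P : uqdata) (M : rmoddata A) : rmoddata A :=
  @RmodData A (uq_tens P M)
    (tens_lift (fun (t : uq_tens P M) (a : A) =>
       tens_lift (fun (p : P) (m : M) => p \ox ract M (m \ox a)) t)).

Definition exact_alg (A : algdata) : Prop :=
  forall (P : uqdata) (M : rmoddata A),
    uq_projective P -> rmodule M -> rmod_projective (tens_rmod P M).

Definition local_rmod (A : algdata) (M : rmoddata A) : Prop :=
  rmodule M /\ (ract M \o (braid A M \o braid M A))%VF = ract M.

Definition lact (A : algdata) (M : rmoddata A) : 'Hom(uq_tens A M, M) :=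
  (ract M \o braid A M)%VF.

(* M (x)_A L is the cokernel of
   m (x) a (x) l |-> m a (x) l - m (x) a l : M (x) A (x) L -> M (x) L. *)
Definition tensA_rel (A : algdata) (M L : rmoddata A) :
    {vspace uq_tens M L} :=
  limg (tens_lift (fun (t : uq_tens M A) (l : L) =>
    tens_lift (fun (m : M) (a : A) =>
      ract M (m \ox a) \ox l - m \ox lact L (a \ox l)) t)).

Definition tensA (A : algdata) (M L : rmoddata A) : vectType k :=
  vquot (tensA_rel M L).

Definition braidA (A : algdata) (M L : rmoddata A) :
    'Hom(tensA M L, tensA L M) :=
  vquot_map (tensA_rel M L) (tensA_rel L M) (braid M L).

Definition in_muger_center (A : algdata) (X : rmoddata A) : Prop :=
  local_rmod X /\
  forall Y : rmoddata A, local_rmod Y -> (braidA Y X \o braidA X Y)%VF = \1%VF.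

Definition dual_basis (V : uqdata) (i : 'I_(\dim {:V})) : uq_dual V :=
  linfun (fun v : V => coord (vbasis {:V}) i v : k^o).

(* The transpose of the multiplication, followed by the canonical isomorphism
   (X (x) Y)^* = Y^* (x) X^*. *)
Definition amul_dual (A : algdata) :
    'Hom(uq_dual A, uq_tens (uq_dual A) (uq_dual A)) :=
  linfun (fun f : 'Hom(A, k^o) =>
    \sum_(i < \dim {:A}) \sum_(j < \dim {:A})
    f (amul A ((vbasis {:A})`_i \ox (vbasis {:A})`_j))
      *: (dual_basis j \ox dual_basis i)).

Definition ev (V : uqdata) : 'Hom(uq_tens (uq_dual V) V, uq_unit) :=
  tens_lift (fun (f : 'Hom(V, k^o)) (v : V) => f v).

Definition dual_rmod (A : algdata) : rmoddata A := @RmodData A (uq_dual A)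
  (tens_lift (fun (f : uq_dual A) (a : A) =>
     tens_lift (fun f1 f2 : uq_dual A => (ev A (f2 \ox a) : k) *: f1)
       (amul_dual A f))).

Lemma dual_ractE (A : algdata) (f : uq_dual A) (a b : A) :
  (ract (dual_rmod A) (f \ox a) : 'Hom(A, k^o)) b
  = (f : 'Hom(A, k^o)) (amul A (a \ox b)).
Proof.
have tensvZl (V W : vectType k) (w : W) : linear (fun v : V => v \ox w).
  move=> c v v'; apply/matrixP => i j.
  by rewrite !mxE linearP mulrDl mulrA.
have tensvZr (V W : vectType k) (v : V) : linear (fun w : W => v \ox w).
  move=> c w w'; apply/matrixP => i j.
  by rewrite !mxE linearP mulrDr mulrCA.
have evE (g : uq_dual A) x : ev A (g \ox x) = (g : 'Hom(A, k^o)) x.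
  rewrite /ev tens_liftE // => [w|v] c v1 v2; last by rewrite linearP.
  by rewrite add_lfunE scale_lfunE.
have dbE (i : 'I_(\dim {:A})) (x : A) :
    (dual_basis i : 'Hom(A, k^o)) x = coord (vbasis {:A}) i x.
  pose F (x : A) : k^o := coord (vbasis {:A}) i x.
  have F_lin : linear F by move=> c y z; rewrite /F linearP.
  pose G : {linear A -> k^o} :=
    HB.pack F (GRing.isLinear.Build k _ _ _ F F_lin).
  exact: (lfunE G).
have lin2 (x : A) (t : uq_dual A) :
    linear (fun f1 : uq_dual A => (ev A (t \ox x) : k) *: f1).
  by move=> c f1 f2; rewrite scalerDr !scalerA mulrC.
have lin2' (x : A) (t : uq_dual A) :
    linear (fun f2 : uq_dual A => (ev A (f2 \ox x) : k) *: t).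
  by move=> c f1 f2; rewrite !evE add_lfunE scale_lfunE scalerDl scalerA.
have mdE (g : uq_dual A) : amul_dual A g =
    \sum_(i < \dim {:A}) \sum_(j < \dim {:A})
      (g : 'Hom(A, k^o)) (amul A ((vbasis {:A})`_i \ox (vbasis {:A})`_j))
      *: (dual_basis j \ox dual_basis i).
  pose F (g : 'Hom(A, k^o)) : uq_tens (uq_dual A) (uq_dual A) :=
    \sum_(i < \dim {:A}) \sum_(j < \dim {:A})
      g (amul A ((vbasis {:A})`_i \ox (vbasis {:A})`_j))
      *: (dual_basis j \ox dual_basis i).
  have F_lin : linear F.
    move=> c g1 g2; rewrite /F scaler_sumr -big_split; apply: eq_bigr => i _ /=.
    rewrite scaler_sumr -big_split; apply: eq_bigr => j _ /=.
    by rewrite add_lfunE scale_lfunE scalerDl scalerA.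
  pose FL := GRing.isLinear.Build k _ _ _ F F_lin.
  pose G : {linear 'Hom(A, k^o) -> uq_tens (uq_dual A) (uq_dual A)} :=
    HB.pack F FL.
  exact: (lfunE G).
have innerE (g : uq_dual A) (x : A) :
    tens_lift (fun f1 f2 : uq_dual A => (ev A (f2 \ox x) : k) *: f1)
      (amul_dual A g) = \sum_(i < \dim {:A}) \sum_(j < \dim {:A})
      ((g : 'Hom(A, k^o)) (amul A ((vbasis {:A})`_i \ox (vbasis {:A})`_j))
       * coord (vbasis {:A}) i x) *: dual_basis j.
  rewrite mdE linear_sum; apply: eq_bigr => i _.
  rewrite linear_sum; apply: eq_bigr => j _.
  by rewrite linearZ /= tens_liftE // evE dbE scalerA.
rewrite /dual_rmod /= tens_liftE => [|x c g1 g2|g c x1 x2]; last 2 first.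
- by rewrite linearP linearP.
- rewrite !innerE scaler_sumr -big_split; apply: eq_bigr => i _ /=.
  rewrite scaler_sumr -big_split; apply: eq_bigr => j _ /=.
  by rewrite linearP mulrDr scalerDl scalerA mulrCA.
pose g (u : tens A A) : k^o := (f : 'Hom(A, k^o)) (amul A u).
have g_lin : linear g by move=> c u u'; rewrite /g !linearP.
pose gL : {linear tens A A -> k^o} :=
  HB.pack g (GRing.isLinear.Build k _ _ _ g g_lin).
pose tl y : {linear A -> tens A A} := HB.pack (fun v : A => v \ox y)
  (GRing.isLinear.Build k _ _ _ (fun v : A => v \ox y) (tensvZl A A y)).
pose tr y : {linear A -> tens A A} := HB.pack (fun v : A => y \ox v)
  (GRing.isLinear.Build k _ _ _ (fun v : A => y \ox v) (tensvZr A A y)).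
rewrite -[RHS]/(gL (tl b a)) [in RHS](coord_vbasis (memvf a)) !linear_sum.
rewrite innerE sum_lfunE; apply: eq_bigr => i _.
rewrite !linearZ /= -[_ \ox b]/(tr _ b) -[g]/(gL : _ -> _).
rewrite [in RHS](coord_vbasis (memvf b)) !linear_sum sum_lfunE.
apply: eq_bigr => j _; rewrite !linearZ /= scale_lfunE dbE.
by rewrite /g -![_ *: _]/(_ * _) mulrC [X in _ * X = _]mulrC.
Qed.

(* k[x] / (x^N) with a given action of E, F and K. *)
Definition tpoly : vectType k := {poly %/ ('X^N : {poly k})}.

Definition tpoly_alg (act : uqops tpoly) : algdata := @AlgData (UqData act)
  (tens_lift (fun a b : {poly %/ ('X^N : {poly k})} => a * b))
  (linfun (fun c : k^o => c *: (1 : {poly %/ ('X^N : {poly k})}))).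

Definition tpoly_action (act : uqops tpoly) : Prop :=
  let x : {poly %/ ('X^N : {poly k})} := 'qX in
  [/\ uq_algebra (tpoly_alg act), opK act x = q ^- 2 *: x,
      opE act x = (1 : {poly %/ ('X^N : {poly k})})
    & opF act x = - q *: x ^+ 2].

End SmallQuantumGroup.

(* e^(i t) *)
Definition cexpi (R : realType) (t : R) : R[i] := (cos t +i* sin t)%C.

(* Main.v *)
(* Everything is made explicit on the basis 1, x, ..., x^(N-1) of A. Put
   t = q^2.

   On x^a (x) x^b the sums over r and s in the R-matrix are Fourier inversions,
   and what remains of mu c (x^a (x) x^b) = x^(a+b), as well as of
   theta (x^a) = x^a, is the Newton-type interpolation identity
     sum_p [a choose p]_t prod_(i < p) (w - t^i) = w^a
   at w = t^(-b) and at w = t^(a-1); for the twist one also needs that the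
   quadratic Gauss sum normalising it is nonzero.

   Exactness: if M is a right A-module, then E and r = (- . x) satisfy
   E r = q^(-2) r E + 1 and are nilpotent, so that every element of M has a
   Taylor expansion with coefficients in ker E, and M is free over k[x]/(x^N).
   Hence Hom_A(M, -) is exact. It takes values in Rep(u_q(sl_2)), and
   Hom(P (x) M, X) = Hom(P, Hom_A(M, X)), which gives the projectivity of
   P (x) M.

   Finally, the functional f |-> f(x^(N-1)) on A^* kills A^* x and the image of
   F and has K-weight q^(-2). Its tensor square descends to A^* (x)_A A^*, and
   there the braiding multiplies it by q^2; as q^4 <> 1, the double braiding of
   A^* with itself is not the identity. *)
Require Import Defs.
From HB Require Import structures.
From mathcomp Require Import all_boot all_order all_algebra.
From mathcomp Require Import reals trigo.
From mathcomp Require Import complex.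
From mathcomp Require Import ring lra.

Set Implicit Arguments.
Unset Strict Implicit.
Unset Printing Implicit Defensive.

Import Order.TTheory GRing.Theory Num.Theory.
Local Open Scope ring_scope.

(** * Gaussian binomials, Newton interpolation and the q-binomial theorem at a root of unity *)

Section Gaussian.
Context {k : fieldType}.
Implicit Types (t w : k) (a p n : nat).

(* The Gaussian binomial; it is the true one only as long as t ^+ i != 1 for
   0 < i <= p, since otherwise a factor is divided by 0. *)
Definition qbin t a p : k :=
  \prod_(i < p) ((t ^+ a / t ^+ i - 1) / (t ^+ i.+1 - 1)).

Lemma qbin0 t a : qbin t a 0 = 1.
Proof. exact: big_ord0. Qed.

Lemma qbin_small t a p : t != 0 -> (a < p)%N -> qbin t a p = 0.
Proof.
move=> t0 ap; rewrite /qbin (bigD1 (Ordinal ap)) //= divff ?expf_neq0 //.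
by rewrite subrr !mul0r.
Qed.

Lemma qbinSr t a p :
  qbin t a p.+1 = qbin t a p * ((t ^+ a / t ^+ p - 1) / (t ^+ p.+1 - 1)).
Proof. exact: big_ord_recr. Qed.

(** Raising both indices shifts the numerator factors, since
    [t ^+ a.+1 / t ^+ i.+1 = t ^+ a / t ^+ i]. Inverses are handled as formal symbols, so vanishing
    denominators do no harm. *)
Lemma qbinSS t a p : t != 0 ->
  qbin t a.+1 p.+1 = qbin t a p * ((t ^+ a.+1 - 1) / (t ^+ p.+1 - 1)).
Proof.
move=> t0; elim: p => [|p IH]; first by rewrite qbinSr !qbin0 expr0 divr1.
rewrite qbinSr IH [qbin t a p.+1]qbinSr.
have -> : t ^+ a.+1 / t ^+ p.+1 = t ^+ a / t ^+ p.
  by rewrite !exprS -mulf_div divff ?mul1r.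
by ring.
Qed.

Lemma qbin_pascal t a p : t != 0 -> t ^+ p.+1 != 1 ->
  qbin t a.+1 p.+1 = qbin t a p + t ^+ p.+1 * qbin t a p.+1.
Proof.
move=> t0; rewrite qbinSS // qbinSr -subr_eq0 [t ^+ a.+1]exprS [t ^+ p.+1]exprS => tp.
by field; rewrite tp expf_neq0.
Qed.

(** Newton interpolation of w^a at the nodes 1, t, t^2, ...: induction on [a], using
    [w * W p = W p.+1 + t ^+ p * W p] for the Newton basis [W] and matching coefficients by Pascal's
    rule. *)
Lemma newton_qbin t w n a : t != 0 ->
    (forall i, (0 < i < n)%N -> t ^+ i != 1) -> (a < n)%N ->
  \sum_(p < n) qbin t a p * \prod_(i < p) (w - t ^+ i) = w ^+ a.
Proof.
move=> t0 t1; elim: a => [|a IH] an.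
  case: n an {t1} => // n _; rewrite big_ord_recl qbin0 big_ord0 mulr1 big1 ?addr0 //.
  by move=> i _; rewrite qbin_small ?mul0r.
case: n => // n in t1 IH an *; pose W p := \prod_(i < p) (w - t ^+ i).
have WS p : w * W p = W p.+1 + t ^+ p * W p.
  by rewrite /W big_ord_recr /=; ring.
rewrite exprS -IH 1?ltnW // mulr_sumr.
under [RHS]eq_bigr => p _ do rewrite -/(W p) mulrCA WS mulrDr.
rewrite big_split /= [X in _ = X + _]big_ord_recr /= qbin_small // mul0r addr0.
rewrite big_ord_recl [X in _ = _ + X]big_ord_recl !qbin0 expr0 !mul1r addrCA.
congr (_ + _); rewrite -big_split; apply: eq_bigr => p _ /=.
rewrite qbin_pascal // ?t1 //= ?ltnS // -/(W _) mulrDl.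
by rewrite [_ * qbin _ _ _]mulrC -mulrA.
Qed.

Lemma iter_linear (V : vectType k) (f : 'End(V)) n : linear (iter n f).
Proof. by elim: n => [|n IH] c u v //=; rewrite IH linearP. Qed.

HB.instance Definition _ (V : vectType k) (f : 'End(V)) n :=
  GRing.isLinear.Build k V V _ (iter n f) (iter_linear f n).

Lemma iter_qcomm (V : vectType k) (f g : 'End(V)) t :
    (forall v, g (f v) = t *: f (g v)) ->
  forall n v, g (iter n f v) = t ^+ n *: iter n f (g v).
Proof.
move=> gf; elim=> [|n IH] v /=; first by rewrite scale1r.
by rewrite gf IH linearZ /= scalerA exprS.
Qed.

(** In the q-binomial expansion of the N-th power only f^N and g^N survive when [t] is a primitive
    N-th root of unity. This gives E^N = F^N = 0 wherever E and F act by sums of two q-commuting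
    operators. *)
Lemma qbinomial_nilpotent (V : vectType k) (f g : 'End(V)) t N : (0 < N)%N ->
    t ^+ N = 1 -> (forall i, (0 < i < N)%N -> t ^+ i != 1) ->
    (forall v, g (f v) = t *: f (g v)) ->
    (forall v, iter N f v = 0) -> (forall v, iter N g v = 0) ->
  forall v, iter N (f + g) v = 0.
Proof.
move=> N0 tN t1 gf fN gN v.
have t0 : t != 0.
  by apply: contra_eq_neq tN => ->; rewrite expr0n gtn_eqF // eq_sym oner_eq0.
(* At n = N the coefficient of iter N f is wrong, but iter N f = 0. *)
have E n : (n <= N)%N -> iter n (f + g)%R v =
    \sum_(p < n.+1) qbin t n p *: iter p f (iter (n - p) g v).
  elim: n => [|n IH] nN; first by rewrite big_ord1 qbin0 scale1r.
  rewrite iterS IH 1?ltnW // add_lfunE !linear_sum /=.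
  rewrite [RHS]big_ord_recl qbin0 scale1r subn0 /=.
  under [X in _ = _ + X]eq_bigr => p _.
    have -> : qbin t n.+1 (lift ord0 p)
          *: iter (lift ord0 p) f (iter (n.+1 - lift ord0 p) g v)
      = (qbin t n p + t ^+ p.+1 * qbin t n p.+1) *: iter p.+1 f (iter (n - p) g v).
      rewrite lift0 subSS; have [pN|pN] := eqVneq p.+1 N.
        by rewrite -pN in fN; rewrite !fN !scaler0.
      rewrite qbin_pascal // t1 //= ltn_neqAle pN /=.
      exact: leq_trans (ltn_ord p) nN.
    rewrite scalerDl.
    over.
  rewrite big_split /= addrCA; congr (_ + _).
    by apply: eq_bigr => p _; rewrite linearZ.
  rewrite big_ord_recl [X in _ = _ + X]big_ord_recr /=.
  rewrite [qbin t n n.+1]qbin_small // mulr0 scale0r addr0.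
  rewrite qbin0 scale1r subn0; congr (_ + _); apply: eq_bigr => p _ /=.
  rewrite /bump add1n linearZ /= -iterS (iter_qcomm gf) scalerA mulrC -iterS.
  by rewrite subnSK.
rewrite E // big1 // => -[[|p] pN] _ /=; first by rewrite subn0 gN scaler0.
have [eN|pN'] := eqVneq p.+1 N; first by rewrite -iterS eN fN scaler0.
(* A middle coefficient contains the factor [t ^+ N - 1], the numerator at i = 0. *)
by rewrite /qbin big_ord_recl /= expr0 divr1 tN subrr !mul0r scale0r.
Qed.

End Gaussian.

(** The route from K^N = 1 to the invertibility of K, on which [actKV], a priori only a generalised
    inverse, depends. *)
Lemma iter_id_inj (T : Type) (f : T -> T) n :
  (0 < n)%N -> (forall x, iter n f x = x) -> injective f.
Proof. by case: n => // n _ fn x y xy; rewrite -(fn x) -(fn y) !iterSr xy. Qed.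

(** * Functorial properties of the tensor product *)

Section TensorMaps.
Context {k : fieldType}.
Implicit Types U V W : vectType k.

Lemma tensv_linear_l V W (w : W) : linear (fun v : V => v \ox w).
Proof. by move=> c v v'; apply/matrixP => i j; rewrite !mxE linearP mulrDl mulrA. Qed.

Lemma tensv_linear_r V W (v : V) : linear (fun w : W => v \ox w).
Proof. by move=> c w w'; apply/matrixP => i j; rewrite !mxE linearP mulrDr mulrCA. Qed.

HB.instance Definition _ V W (v : V) :=
  GRing.isLinear.Build k W (tens V W) _ (tensv v) (@tensv_linear_r V W v).

(** A named left-hand version of [tensv], so that each variable carries its own linear structure. *)
Definition tensvl V W (w : W) (v : V) : tens V W := v \ox w.

HB.instance Definition _ V W (w : W) :=
  GRing.isLinear.Build k V (tens V W) _ (tensvl w) (@tensv_linear_l V W w).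

Lemma tensvDl V W (v v' : V) (w : W) : (v + v') \ox w = v \ox w + v' \ox w.
Proof. exact: (linearD (tensvl w)). Qed.

Lemma tensvBl V W (v v' : V) (w : W) : (v - v') \ox w = v \ox w - v' \ox w.
Proof. exact: (linearB (tensvl w)). Qed.

Lemma tensvZl V W c (v : V) (w : W) : (c *: v) \ox w = c *: (v \ox w).
Proof. exact: (linearZZ (tensvl w)). Qed.

Lemma tensv0l V W (w : W) : (0 : V) \ox w = 0.
Proof. exact: (linear0 (tensvl w)). Qed.

Lemma tensvDr V W (v : V) (w w' : W) : v \ox (w + w') = v \ox w + v \ox w'.
Proof. exact: linearD. Qed.

Lemma tensvBr V W (v : V) (w w' : W) : v \ox (w - w') = v \ox w - v \ox w'.
Proof. exact: linearB. Qed.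

Lemma tensvZr V W c (v : V) (w : W) : v \ox (c *: w) = c *: (v \ox w).
Proof. exact: linearZZ. Qed.

Lemma tensv0r V W (v : V) : v \ox (0 : W) = 0.
Proof. exact: linear0. Qed.

Lemma linfunE V W (f : V -> W) : linear f -> linfun f =1 f.
Proof.
move=> fL v.
pose g : {linear V -> W} := HB.pack f (GRing.isLinear.Build k _ _ _ f fL).
exact: (lfunE g).
Qed.

Lemma eq_linear_tens V W U (f g : tens V W -> U) : linear f -> linear g ->
  (forall v w, f (v \ox w) = g (v \ox w)) -> f =1 g.
Proof.
move=> fL gL fg t; rewrite -(linfunE fL) -(linfunE gL).
by congr (fun_of_lfun _ t); apply: tens_ext => v w; rewrite !linfunE.
Qed.

Definition tens_map V W V' W' (f : 'Hom(V, V')) (g : 'Hom(W, W')) :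
    'Hom(tens V W, tens V' W') :=
  tens_lift (fun v w => f v \ox g w).

Lemma tens_mapE V W V' W' (f : 'Hom(V, V')) (g : 'Hom(W, W')) v w :
  tens_map f g (v \ox w) = f v \ox g w.
Proof.
rewrite /tens_map tens_liftE // => [w'|v'] c x y.
  by rewrite linearP tensvDl tensvZl.
by rewrite !linearP.
Qed.

Lemma iter_tens_map V W (f : 'End(V)) (g : 'End(W)) n v w :
  iter n (tens_map f g) (v \ox w) = iter n f v \ox iter n g w.
Proof. by elim: n => //= n ->; rewrite tens_mapE. Qed.

End TensorMaps.

(** * Tensor products of modules *)

Section Modules.
Context {k : fieldType} {N : nat} {q : k}.
Hypotheses (N_odd : odd N) (q_prim : N.-primitive_root q).
Implicit Types V W : uqdata (k := k).

Local Lemma N_gt0 : (0 < N)%N. Proof. exact: odd_gt0. Qed.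

Lemma q_neq0 : q != 0.
Proof.
apply: contra_eq_neq (prim_expr_order q_prim) => ->.
by rewrite expr0n gtn_eqF ?N_gt0 // eq_sym oner_eq0.
Qed.

Lemma q2_prim : N.-primitive_root (q ^+ 2).
Proof. by rewrite prim_root_exp_coprime // coprime2n. Qed.

Lemma prim_expr_neq1 (t : k) : N.-primitive_root t ->
  forall i, (0 < i < N)%N -> t ^+ i != 1.
Proof.
move=> t_prim i /andP[i0 iN]; rewrite -(prim_order_dvd t_prim).
by apply/negP => /(dvdn_leq i0); rewrite leqNgt iN.
Qed.

(** The inverse is [t ^+ N.-1], and N - 1 is coprime to N. *)
Lemma prim_rootV (t : k) : N.-primitive_root t -> N.-primitive_root t^-1.
Proof.
move=> t_prim; have : N.-primitive_root (t ^+ N.-1).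
  by rewrite prim_root_exp_coprime // coprimePn ?N_gt0.
congr (N.-primitive_root _).
have t0 : t != 0.
  apply: contra_eq_neq (prim_expr_order t_prim) => ->.
  by rewrite expr0n gtn_eqF ?N_gt0 // eq_sym oner_eq0.
apply: (mulfI t0); rewrite -exprS prednK ?N_gt0 // divff //.
exact: prim_expr_order.
Qed.

Section OneModule.
Context {V : uqdata (k := k)}.
Hypothesis V_mod : uq_module N q V.

Lemma actK_inj : injective (actK V).
Proof. exact: iter_id_inj N_gt0 (uq_KN V_mod). Qed.

Lemma actKVK v : actKV V (actK V v) = v.
Proof. by apply: lker0_lfunK; apply/lker0P/actK_inj. Qed.

Lemma actKKV v : actK V (actKV V v) = v.
Proof. by apply: lker0_lfunVK; apply/lker0P/actK_inj. Qed.

Lemma actKVE v : actKV V (actE V v) = q ^- 2 *: actE V (actKV V v).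
Proof.
apply: actK_inj; rewrite actKKV linearZ /= (uq_KE V_mod) actKKV scalerA.
by rewrite mulVf ?scale1r // expf_neq0 ?q_neq0.
Qed.

Lemma actKVF v : actKV V (actF V v) = q ^+ 2 *: actF V (actKV V v).
Proof.
apply: actK_inj; rewrite actKKV linearZ /= (uq_KF V_mod) actKKV scalerA.
by rewrite mulfV ?scale1r // expf_neq0 ?q_neq0.
Qed.

End OneModule.

Section TensorModule.
Context {V W : uqdata (k := k)}.

(** Operator form of the coproduct: on modules the two summands q-commute, as [qbinomial_nilpotent]
    requires. *)
Lemma tens_actEl : actE (uq_tens V W) = tens_map (actE V) (actK W) + tens_map \1 (actE W).
Proof.
apply: tens_ext => v w; rewrite add_lfunE !tens_mapE id_lfunE tens_liftE //.
- by move=> w' c x y; rewrite linearP !tensvDl !tensvZl scalerDr addrACA.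
- by move=> v' c x y; rewrite !linearP scalerDr addrACA.
Qed.

Lemma tens_actFl : actF (uq_tens V W) = tens_map (actF V) \1 + tens_map (actKV V) (actF W).
Proof.
apply: tens_ext => v w; rewrite add_lfunE !tens_mapE id_lfunE tens_liftE //.
- by move=> w' c x y; rewrite !linearP !tensvDl !tensvZl scalerDr addrACA.
- by move=> v' c x y; rewrite !linearP scalerDr addrACA.
Qed.

Lemma tens_actKl : actK (uq_tens V W) = tens_map (actK V) (actK W).
Proof. by []. Qed.

Lemma tens_actE v w :
  actE (uq_tens V W) (v \ox w) = actE V v \ox actK W w + v \ox actE W w.
Proof. by rewrite tens_actEl add_lfunE !tens_mapE id_lfunE. Qed.

Lemma tens_actF v w :
  actF (uq_tens V W) (v \ox w) = actF V v \ox w + actKV V v \ox actF W w.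
Proof. by rewrite tens_actFl add_lfunE !tens_mapE id_lfunE. Qed.

Lemma tens_actK v w : actK (uq_tens V W) (v \ox w) = actK V v \ox actK W w.
Proof. by rewrite tens_actKl tens_mapE. Qed.

Hypotheses (V_mod : uq_module N q V) (W_mod : uq_module N q W).

Lemma tens_KN u : iter N (actK (uq_tens V W)) u = u.
Proof.
apply: (@eq_linear_tens _ V W _ _ id) u => [|//|v w]; first exact: iter_linear.
by rewrite tens_actKl iter_tens_map (uq_KN V_mod) (uq_KN W_mod).
Qed.

Lemma tens_actKV v w : actKV (uq_tens V W) (v \ox w) = actKV V v \ox actKV W w.
Proof.
have K_inj := iter_id_inj N_gt0 tens_KN.
apply: (K_inj); rewrite /actKV lker0_lfunVK; last exact/lker0P.
by rewrite tens_actK !actKKV.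
Qed.

(** E and F are sums of two operators that q-commute with parameters q^-2 and q^2, so their N-th
    powers vanish. The remaining relations are checked on pure tensors. *)
Lemma uq_tens_module : uq_module N q (uq_tens V W).
Proof.
have q2p := q2_prim; have q2vp := prim_rootV q2p.
have q0 := q_neq0; have q20 : q ^+ 2 != 0 by rewrite expf_neq0.
split.
- exact: tens_KN.
- rewrite tens_actEl.
  apply: qbinomial_nilpotent N_gt0 (prim_expr_order q2vp) (prim_expr_neq1 q2vp) _ _ _ => u.
  + rewrite -!comp_lfunE -scale_lfunE; congr (fun_of_lfun _ u); apply: tens_ext => v w.
    rewrite scale_lfunE !comp_lfunE !tens_mapE !id_lfunE (uq_KE W_mod) tensvZr.
    by rewrite scalerA mulVf // scale1r.
  + apply: (@eq_linear_tens _ V W _ _ (fun=> 0)) u => [|c x y|v w].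
    * exact: iter_linear.
    * by rewrite scaler0 addr0.
    * by rewrite iter_tens_map (uq_EN V_mod) tensv0l.
  + apply: (@eq_linear_tens _ V W _ _ (fun=> 0)) u => [|c x y|v w].
    * exact: iter_linear.
    * by rewrite scaler0 addr0.
    * by rewrite iter_tens_map (uq_EN W_mod) tensv0r.
- rewrite tens_actFl.
  apply: qbinomial_nilpotent N_gt0 (prim_expr_order q2p) (prim_expr_neq1 q2p) _ _ _ => u.
  + rewrite -!comp_lfunE -scale_lfunE; congr (fun_of_lfun _ u); apply: tens_ext => v w.
    by rewrite scale_lfunE !comp_lfunE !tens_mapE !id_lfunE (actKVF V_mod) tensvZl.
  + apply: (@eq_linear_tens _ V W _ _ (fun=> 0)) u => [|c x y|v w].
    * exact: iter_linear.
    * by rewrite scaler0 addr0.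
    * by rewrite iter_tens_map (uq_FN V_mod) tensv0l.
  + apply: (@eq_linear_tens _ V W _ _ (fun=> 0)) u => [|c x y|v w].
    * exact: iter_linear.
    * by rewrite scaler0 addr0.
    * by rewrite iter_tens_map (uq_FN W_mod) tensv0r.
- move=> u; rewrite -!comp_lfunE -scale_lfunE; congr (fun_of_lfun _ u); apply: tens_ext => v w.
  rewrite scale_lfunE !comp_lfunE tens_actE tens_actK linearD /= !tens_actK tens_actE.
  by rewrite (uq_KE V_mod) (uq_KE W_mod) tensvZl tensvZr scalerDr.
- move=> u; rewrite -!comp_lfunE -scale_lfunE; congr (fun_of_lfun _ u); apply: tens_ext => v w.
  rewrite scale_lfunE !comp_lfunE tens_actF tens_actK linearD /= !tens_actK tens_actF.
  rewrite (uq_KF V_mod) (uq_KF W_mod) tensvZl tensvZr scalerDr.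
  by rewrite (actKKV V_mod) (actKVK V_mod).
- move=> u; rewrite -!comp_lfunE -!(add_lfunE, opp_lfunE, scale_lfunE).
  congr (fun_of_lfun _ u); apply: tens_ext => v w.
  rewrite !(add_lfunE, opp_lfunE, scale_lfunE) !comp_lfunE tens_actE tens_actF !linearD /=.
  rewrite tens_actK tens_actKV !tens_actE !tens_actF (actKVE V_mod) (uq_KF W_mod).
  rewrite tensvZl tensvZr.
  (* On each factor E F is replaced by F E plus the commutator. The mixed terms then cancel, and
     entrywise comparison leaves ring identities. *)
  have EFv := uq_EF V_mod v; have EFw := uq_EF W_mod w.
  have -> : actE V (actF V v) = actF V (actE V v) + (q - q^-1)^-1 *: (actK V v - actKV V v).
    by rewrite -EFv addrC subrK.
  have -> : actE W (actF W w) = actF W (actE W w) + (q - q^-1)^-1 *: (actK W w - actKV W w).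
    by rewrite -EFw addrC subrK.
  rewrite !(tensvDl, tensvDr, tensvBl, tensvBr, tensvZl, tensvZr).
  by apply/matrixP => i j; rewrite !mxE; ring.
Qed.

End TensorModule.
End Modules.

(** * Taylor expansion with respect to a q-derivative *)

Section Taylor.
Context {k : fieldType} {V : vectType k} {N : nat} {Q : k} {e r : 'End(V)}.
Hypotheses (er : forall v, e (r v) = Q *: r (e v) + v).
Hypotheses (rN : forall v, iter N r v = 0) (eN : forall v, iter N e v = 0).

Definition qint n : k := \sum_(i < n) Q ^+ i.

Hypothesis qint_neq0 : forall n, (0 < n < N)%N -> qint n != 0.

Lemma qintS n : qint n.+1 = 1 + Q * qint n.
Proof.
rewrite /qint big_ord_recl expr0 mulr_sumr; congr (_ + _).
by apply: eq_bigr => i _; rewrite -exprS.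
Qed.

Lemma qintSr n : qint n.+1 = qint n + Q ^+ n.
Proof. exact: big_ord_recr. Qed.

(** With [e] as q-derivative and [r] as multiplication by x, this is the q-analogue of d^n x = x d^n
    + n d^(n-1) for d = d/dx; [qderiv_iter] is its mirror image. *)
Lemma iter_qderiv n v :
  iter n.+1 e (r v) = Q ^+ n.+1 *: r (iter n.+1 e v) + qint n.+1 *: iter n e v.
Proof.
elim: n => [|n IH]; first by rewrite /qint big_ord1 /= er scale1r.
rewrite iterS IH linearD !linearZ /= er scalerDr scalerA -exprSr -addrA -scalerDl.
by rewrite [qint n.+2]qintSr addrC [in qint _ + _]addrC addrC.
Qed.

Lemma qderiv_iter n v :
  e (iter n.+1 r v) = Q ^+ n.+1 *: iter n.+1 r (e v) + qint n.+1 *: iter n r v.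
Proof.
elim: n => [|n IH]; first by rewrite /qint big_ord1 /= er scale1r.
rewrite iterS er IH linearD !linearZ /= scalerDr !scalerA -exprS -addrA.
by rewrite [qint n.+2]qintS addrC [1 + _]addrC scalerDl scale1r addrC.
Qed.

(** Equal to (-1)^n Q^(n(n-1)/2) / [n]!, and [taylor_coef] below to 1 / [n]!, with the q-factorial
    in Q. *)
Definition proj_coef n : k := \prod_(j < n) (- Q ^+ j / qint j.+1).
Definition taylor_coef n : k := \prod_(j < n) (qint j.+1)^-1.

(** The constant-term projector: it takes values in ker e, is the identity there and kills the image
    of [r]. *)
Definition ker_proj v := \sum_(i < N) proj_coef i *: iter i r (iter i e v).

Lemma ker_proj_linear : linear ker_proj.
Proof.
move=> c u v; rewrite /ker_proj scaler_sumr -big_split; apply: eq_bigr => i _ /=.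
by rewrite !linearP /= !scalerA mulrC.
Qed.

HB.instance Definition _ := GRing.isLinear.Build k V V _ ker_proj ker_proj_linear.

Lemma proj_coefS n : (n.+1 < N)%N ->
  proj_coef n.+1 * qint n.+1 = - (proj_coef n * Q ^+ n).
Proof.
move=> nN; rewrite /proj_coef big_ord_recr /= -mulrA divfK ?mulrN //.
by rewrite qint_neq0.
Qed.

Lemma taylor_coefS n : (n.+1 < N)%N -> taylor_coef n.+1 * qint n.+1 = taylor_coef n.
Proof.
by move=> nN; rewrite /taylor_coef big_ord_recr /= divfK // qint_neq0.
Qed.

(* Both compositions telescope: the two halves of the commutation relation
   contribute opposite multiples of consecutive monomials. *)
Lemma ker_proj_r v : ker_proj (r v) = 0.
Proof.
pose A i := if i is j.+1 then (proj_coef j * Q ^+ j) *: iter j.+1 r (iter j e v) else 0.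
transitivity (\sum_(0 <= i < N) (A i.+1 - A i)).
  rewrite big_mkord; apply: eq_bigr => -[[|i] iN] _ /=.
    by rewrite expr0 mulr1 subr0.
  rewrite -!iterS iter_qderiv linearD !linearZ /= scalerDr !scalerA proj_coefS //.
  by rewrite scaleNr scalerN -iterSr.
rewrite telescope_sumr // subr0 /A; case: N rN => // n rn.
by rewrite rn scaler0.
Qed.

Lemma qderiv_ker_proj v : e (ker_proj v) = 0.
Proof.
pose B i := if i is j.+1 then (proj_coef j * Q ^+ j) *: iter j r (iter j.+1 e v) else 0.
transitivity (\sum_(0 <= i < N) (B i.+1 - B i)).
  rewrite big_mkord linear_sum; apply: eq_bigr => -[[|i] iN] _ /=.
    by rewrite linearZ expr0 mulr1 subr0.
  rewrite linearZ /= -!iterS qderiv_iter scalerDr !scalerA proj_coefS //.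
  by rewrite scaleNr.
rewrite telescope_sumr // subr0 /B; case: N eN => // n en.
by rewrite en linear0 ?scaler0.
Qed.

Lemma ker_proj_id v : e v = 0 -> ker_proj v = v.
Proof.
move=> ev; rewrite /ker_proj; case: N eN => [|n] en.
  by rewrite big_ord0 -(en v).
rewrite big_ord_recl /proj_coef big_ord0 scale1r big1 ?addr0 // => i _.
by rewrite lift0 [iter i.+1 e v]iterSr ev !linear0 ?scaler0.
Qed.

(* The Taylor expansion of v, with coefficients transported along f. *)
Definition taylor_lift (W : vectType k) (s : 'End(W)) (f : 'Hom(V, W)) v :=
  \sum_(i < N) taylor_coef i *: iter i s (f (ker_proj (iter i e v))).

Lemma taylor_lift_linear W s f : linear (@taylor_lift W s f).
Proof.
move=> c u v; rewrite /taylor_lift scaler_sumr -big_split; apply: eq_bigr => i _ /=.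
by rewrite !linearP /= !scalerA mulrC.
Qed.

(** The Taylor coefficients of [r v] are those of [v] moved up one degree: the other summand of the
    Leibniz rule lies in the image of [r] and is killed. *)
Lemma ker_proj_qderiv n v :
  ker_proj (iter n.+1 e (r v)) = qint n.+1 *: ker_proj (iter n e v).
Proof. by rewrite iter_qderiv linearD !linearZ /= ker_proj_r scaler0 add0r. Qed.

(** An index shift whose boundary terms vanish: in degree 0 because [ker_proj] kills the image of
    [r], at the top because s^N = 0. Lifting coefficients thus gives a map that intertwines [r] and
    [s]. *)
Lemma taylor_lift_r (W : vectType k) (s : 'End(W)) f v : (forall w, iter N s w = 0) ->
  taylor_lift s f (r v) = s (taylor_lift s f v).
Proof.
rewrite /taylor_lift linear_sum; case: N taylor_coefS => [|n] cS sN.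
  by rewrite !big_ord0.
rewrite big_ord_recl [RHS]big_ord_recr /= -[ker_proj]/ker_proj ker_proj_r !linear0 ?scaler0 add0r.
rewrite [X in _ + X]linearZ /= -iterS sN scaler0 addr0; apply: eq_bigr => i _.
rewrite /= /bump add1n -!iterS ker_proj_qderiv !linearZ /= scalerA.
by rewrite add0n mulrC cS ?ltnS.
Qed.

(** The expansion [T] commutes with [e] and preserves constant terms. So if T fixes e u, then T u -
    u lies in ker e and has constant term 0, hence is 0. *)
Lemma taylor v : taylor_lift r \1%VF v = v.
Proof.
pose T := taylor_lift r \1%VF.
have TL : linear T by apply: taylor_lift_linear.
pose fT : {linear V -> V} := HB.pack T (GRing.isLinear.Build k _ _ _ T TL).
have eT u : e (T u) = T (e u).
  rewrite /T /taylor_lift linear_sum; case: N eN taylor_coefS => [|n] en cS.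
    by rewrite !big_ord0.
  rewrite big_ord_recl [RHS]big_ord_recr /= id_lfunE linearZ /= qderiv_ker_proj.
  rewrite scaler0 add0r -!iterSr en !linear0 ?scaler0 addr0; apply: eq_bigr => i _.
  rewrite linearZ /= /bump add1n -!iterS !id_lfunE qderiv_iter qderiv_ker_proj linear0 ?scaler0.
  by rewrite add0r scalerA cS ?ltnS // -iterSr.
have pT u : ker_proj (T u) = ker_proj u.
  rewrite /T /taylor_lift linear_sum; case: N eN => [|n] en.
    by have -> : u = 0 := en u; rewrite big_ord0 linear0.
  rewrite big_ord_recl /= big1 ?addr0 => [|i _].
    rewrite /taylor_coef big_ord0 scale1r id_lfunE.
    by rewrite ker_proj_id // qderiv_ker_proj.
  by rewrite linearZ /= ker_proj_r scaler0.
(* Induction on the order of nilpotency of [e] at [u], which is at most N. *)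
suff main n u : iter n e u = 0 -> T u = u by apply: (main N).
elim: n u => [|n IH] u /= eu; first by rewrite eu; apply: (linear0 fT).
have /IH eTu : iter n e (e u) = 0 by rewrite -iterSr.
have : e (T u - u) = 0 by rewrite linearB /= eT eTu subrr.
by move/ker_proj_id; rewrite linearB /= pT subrr => /esym/subr0_eq.
Qed.

End Taylor.

(** Turns vector identities into scalar ones, within reach of [ring] and [field]. *)
Lemma coord_ext (k : fieldType) (V : vectType k) (u v : V) :
  (forall i, coord (vbasis {:V}) i u = coord (vbasis {:V}) i v) -> u = v.
Proof.
move=> uv; rewrite (coord_vbasis (memvf u)) (coord_vbasis (memvf v)).
by apply: eq_bigr => i _; rewrite uv.
Qed.

Section Nilpotent.
Context {k : fieldType} {V : vectType k}.

(** By q-commutation (g f)^n and (f g)^n are both scalar multiples of f^n g^n. Applied to E K^-1 and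
    K F, which enter through the antipode. *)
Lemma nilpotent_qcomp (f g : 'End(V)) (t : k) N :
    (forall v, g (f v) = t *: f (g v)) -> (forall v, iter N f v = 0) ->
  (forall v, iter N (g \o f)%VF v = 0) /\ (forall v, iter N (f \o g)%VF v = 0).
Proof.
move=> gf fN.
have gfE n v : exists c, iter n (g \o f)%VF v = c *: iter n f (iter n g v).
  elim: n => [|n [c E]] /=; first by exists 1; rewrite scale1r.
  exists (c * t ^+ n.+1).
  by rewrite E comp_lfunE !linearZ /= -iterS (iter_qcomm gf) scalerA.
have fgE n v : exists c, iter n (f \o g)%VF v = c *: iter n f (iter n g v).
  elim: n => [|n [c E]] /=; first by exists 1; rewrite scale1r.
  exists (c * t ^+ n).
  by rewrite E comp_lfunE !linearZ /= (iter_qcomm gf) linearZ /= scalerA.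
by split=> v; [have [c ->] := gfE N v | have [c ->] := fgE N v]; rewrite fN scaler0.
Qed.

End Nilpotent.

(** * The internal Hom as a module *)

Section InternalHom.
Context {k : fieldType}.

Definition conj_lfun (V V' W W' : vectType k) (a : 'Hom(W, W')) (b : 'Hom(V', V)) :
    'Hom('Hom(V, W), 'Hom(V', W')) :=
  linfun (fun f : 'Hom(V, W) => a \o f \o b)%VF.

Lemma conj_lfunE (V V' W W' : vectType k) (a : 'Hom(W, W')) (b : 'Hom(V', V)) f v :
  conj_lfun a b f v = a (f (b v)).
Proof.
rewrite /conj_lfun linfunE ?comp_lfunE // => c f1 f2; apply/lfunP => u.
by rewrite !(add_lfunE, scale_lfunE, comp_lfunE) linearP.
Qed.

Lemma iter_conj_lfun (V W : vectType k) (a : 'End(W)) (b : 'End(V)) n f v :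
  iter n (conj_lfun a b) f v = iter n a (f (iter n b v)).
Proof. by elim: n v => //= n IH v; rewrite conj_lfunE IH -iterSr. Qed.

(* The internal Hom: h acts by f |-> h_1 f(S(h_2) -). *)
Definition uq_ihom (V W : uqdata (k := k)) : uqdata := @UqData k 'Hom(V, W) (UqOps
  (conj_lfun (actE W) (actKV V) + conj_lfun (- \1)%VF (actE V \o actKV V)%VF)
  (conj_lfun (actF W) \1%VF + conj_lfun (- actKV W)%VF (actK V \o actF V)%VF)
  (conj_lfun (actK W) (actKV V))).

Context {N : nat} {q : k}.
Hypotheses (N_odd : odd N) (q_prim : N.-primitive_root q).
Context {V W : uqdata (k := k)}.
Implicit Types (f : 'Hom(V, W)) (v : V).

Lemma ihom_actE f v : (actE (uq_ihom V W) f : 'Hom(V, W)) v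
  = actE W (f (actKV V v)) - f (actE V (actKV V v)).
Proof.
by rewrite /actE /= add_lfunE add_lfunE !conj_lfunE opp_lfunE id_lfunE comp_lfunE.
Qed.

Lemma ihom_actF f v : (actF (uq_ihom V W) f : 'Hom(V, W)) v
  = actF W (f v) - actKV W (f (actK V (actF V v))).
Proof.
by rewrite /actF /= add_lfunE add_lfunE !conj_lfunE opp_lfunE id_lfunE comp_lfunE.
Qed.

Lemma ihom_actK f v : (actK (uq_ihom V W) f : 'Hom(V, W)) v
  = actK W (f (actKV V v)).
Proof. by rewrite /actK /= conj_lfunE. Qed.

Hypotheses (V_mod : uq_module N q V) (W_mod : uq_module N q W).

Lemma iter_actKV v : iter N (actKV V) v = v.
Proof.
rewrite -{1}(uq_KN V_mod v); elim: {1 2}N v => // n IH v.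
by rewrite iterSr iterS (actKVK N_odd V_mod) IH.
Qed.

Lemma ihom_KN f : iter N (actK (uq_ihom V W)) f = f.
Proof.
by apply/lfunP => v; rewrite iter_conj_lfun (uq_KN W_mod) iter_actKV.
Qed.

Lemma ihom_actKV f v : (actKV (uq_ihom V W) f : 'Hom(V, W)) v
  = actKV W (f (actK V v)).
Proof.
have K_inj := iter_id_inj (odd_gt0 N_odd) ihom_KN.
rewrite -(conj_lfunE (actKV W) (actK V)); congr (fun_of_lfun _ v); apply: (K_inj).
rewrite /actKV lker0_lfunVK; last exact/lker0P.
apply/lfunP => u; rewrite ihom_actK conj_lfunE.
by rewrite (actKKV N_odd W_mod) (actKKV N_odd V_mod).
Qed.

(** As for tensor products, the two terms of E, and those of F, q-commute as operators on Hom(V, W).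
    The long computation is the relation between E and F. *)
Lemma uq_ihom_module : uq_module N q (uq_ihom V W).
Proof.
have N0 := odd_gt0 N_odd.
have q2p := q2_prim N_odd q_prim; have q2vp := prim_rootV N_odd q2p.
have q20 : q ^+ 2 != 0 by rewrite expf_neq0 // (q_neq0 N_odd q_prim).
have KK := (actKKV N_odd W_mod, actKVK N_odd W_mod, actKKV N_odd V_mod, actKVK N_odd V_mod).
split.
- exact: ihom_KN.
- apply: qbinomial_nilpotent N0 (prim_expr_order q2vp) (prim_expr_neq1 q2vp) _ _ _ => f.
  + apply/lfunP => v; rewrite scale_lfunE !conj_lfunE !(opp_lfunE, id_lfunE, comp_lfunE).
    by rewrite (actKVE N_odd q_prim V_mod) linearN /= scalerN !linearZ.
  + by apply/lfunP => v; rewrite iter_conj_lfun zero_lfunE (uq_EN W_mod).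
  + apply/lfunP => v; rewrite iter_conj_lfun zero_lfunE.
    have [_ ->] := nilpotent_qcomp (actKVE N_odd q_prim V_mod) (uq_EN V_mod).
    by rewrite !linear0.
- apply: qbinomial_nilpotent N0 (prim_expr_order q2p) (prim_expr_neq1 q2p) _ _ _ => f.
  + apply/lfunP => v; rewrite scale_lfunE !conj_lfunE !(opp_lfunE, id_lfunE, comp_lfunE).
    by rewrite (actKVF N_odd q_prim W_mod) linearN /= scalerN.
  + by apply/lfunP => v; rewrite iter_conj_lfun zero_lfunE (uq_FN W_mod).
  + apply/lfunP => v; rewrite iter_conj_lfun zero_lfunE.
    have [-> _] := nilpotent_qcomp (uq_KF V_mod) (uq_FN V_mod).
    by rewrite !linear0.
- move=> f; apply/lfunP => v; rewrite scale_lfunE ihom_actK !ihom_actE !ihom_actK.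
  rewrite linearB /= (uq_KE W_mod) scalerBr.
  by rewrite (actKVE N_odd q_prim V_mod) !linearZ /= scalerA divff // scale1r.
- move=> f; apply/lfunP => v; rewrite scale_lfunE ihom_actK !ihom_actF !ihom_actK.
  rewrite linearB /= (uq_KF W_mod) scalerBr !KK.
  by rewrite (uq_KF V_mod) !KK linearZ.
- move=> f; apply/lfunP => v.
  rewrite [LHS]add_lfunE [X in _ + X = _]opp_lfunE [RHS]scale_lfunE.
  rewrite [X in _ = _ *: X]add_lfunE [X in _ = _ *: (_ + X)]opp_lfunE.
  rewrite ihom_actE ihom_actF ihom_actK ihom_actKV.
  rewrite !ihom_actF !ihom_actE !KK.
  (* Substituting v = K u cancels the K^-1 brought in by the antipode; E and F are then moved inside
     K by [FK] and [EK]. *)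
  rewrite -{-1}[v](actKKV N_odd V_mod); move: (actKV V v) => u.
  have FK w : actF V (actK V w) = q ^+ 2 *: actK V (actF V w).
    by rewrite (uq_KF V_mod) scalerA divff // scale1r.
  have EK w : actE V (actK V w) = q ^- 2 *: actK V (actE V w).
    by rewrite (uq_KE V_mod) scalerA mulVf // scale1r.
  have EFu : actE V (actF V u) = (q - q^-1)^-1 *: (actK V u - actKV V u) + actF V (actE V u).
    by apply/eqP; rewrite -subr_eq (uq_EF V_mod).
  have EFfu : actE W (actF W (f u)) =
      (q - q^-1)^-1 *: (actK W (f u) - actKV W (f u)) + actF W (actE W (f u)).
    by apply/eqP; rewrite -subr_eq (uq_EF W_mod).
  rewrite !KK FK (linearB (actE W)) (linearB (actF W)) !(linearB (actKV W)) /=.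
  have -> : f (actE V (q ^+ 2 *: actK V (actF V u))) = f (actK V (actE V (actF V u))).
    by rewrite (linearZZ (actE V)) /= EK scalerA divff // scale1r.
  have -> : actKV W (actE W (f (q ^+ 2 *: actK V (actF V u))))
      = actE W (actKV W (f (actK V (actF V u)))).
    by rewrite (actKVE N_odd q_prim W_mod) !linearZ /= scalerA divff // scale1r.
  rewrite EFfu EFu (linearD (actK V)) (linearD (f : 'Hom(V, W))) (linearD (actKV W)) /=.
  rewrite (linearZZ (actK V)) (linearZZ (f : 'Hom(V, W))) (linearZZ (actKV W)) /=.
  rewrite (linearB (actK V)) (linearB (f : 'Hom(V, W))) (linearB (actKV W)) /= !KK.
  move: (q - q^-1)^-1 => c.
  apply: coord_ext => i; rewrite !(linearB, linearD, linearN, linearZ) /=; ring.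
Qed.

End InternalHom.

(** * Submodules and morphisms *)

Section Submodule.
Context {k : fieldType} {N : nat} {q : k}.
Hypotheses (N_odd : odd N).
Context {V : uqdata (k := k)} (U : {vspace V}).

(** Restriction followed by projection to U, which makes sense for every U and is the restricted
    action once U is stable. *)
Definition uq_sub : uqdata := @UqData k (subvs_of U) (UqOps
  (linfun (vsproj U \o actE V \o vsval))
  (linfun (vsproj U \o actF V \o vsval))
  (linfun (vsproj U \o actK V \o vsval))).

Hypotheses (UE : forall u, u \in U -> actE V u \in U)
  (UF : forall u, u \in U -> actF V u \in U)
  (UK : forall u, u \in U -> actK V u \in U).

Lemma vsval_actE (u : uq_sub) : vsval (actE uq_sub u) = actE V (vsval u).
Proof. by rewrite /actE /= lfunE /= vsprojK // UE // subvsP. Qed.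

Lemma vsval_actF (u : uq_sub) : vsval (actF uq_sub u) = actF V (vsval u).
Proof. by rewrite /actF /= lfunE /= vsprojK // UF // subvsP. Qed.

Lemma vsval_actK (u : uq_sub) : vsval (actK uq_sub u) = actK V (vsval u).
Proof. by rewrite /actK /= lfunE /= vsprojK // UK // subvsP. Qed.

Hypothesis V_mod : uq_module N q V.

Lemma uq_sub_KN u : iter N (actK uq_sub) u = u.
Proof.
apply: val_inj; rewrite -[RHS](uq_KN V_mod) /=.
by elim: {1 2}N => //= n IH; rewrite vsval_actK IH.
Qed.

Lemma vsval_actKV (u : uq_sub) : vsval (actKV uq_sub u) = actKV V (vsval u).
Proof.
have K_inj := iter_id_inj (odd_gt0 N_odd) uq_sub_KN.
apply: (actK_inj N_odd V_mod); rewrite (actKKV N_odd V_mod) -vsval_actK.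
by rewrite /actKV lker0_lfunVK //; apply/lker0P.
Qed.

Lemma uq_sub_module : uq_module N q uq_sub.
Proof.
have iterP (f : 'End(uq_sub)) (g : 'End(V)) n (u : uq_sub) :
    (forall u : uq_sub, vsval (f u) = g (vsval u)) ->
    vsval (iter n f u) = iter n g (vsval u).
  by move=> fg; elim: n => //= n IH; rewrite fg IH.
split=> [u|u|u|u|u|u]; first exact: uq_sub_KN; apply: val_inj => /=.
- by rewrite (iterP _ (actE V)) ?(uq_EN V_mod) //; apply: vsval_actE.
- by rewrite (iterP _ (actF V)) ?(uq_FN V_mod) //; apply: vsval_actF.
- by rewrite vsval_actK !vsval_actE vsval_actK (uq_KE V_mod).
- by rewrite vsval_actK !vsval_actF vsval_actK (uq_KF V_mod).
- by rewrite vsval_actE !vsval_actF vsval_actE vsval_actK vsval_actKV (uq_EF V_mod).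
Qed.

End Submodule.

Section Homs.
Context {k : fieldType} {N : nat} {q : k}.
Hypotheses (N_odd : odd N).
Context {V W : uqdata (k := k)}.
Hypotheses (V_mod : uq_module N q V) (W_mod : uq_module N q W).

Lemma uq_hom_actKV (f : 'Hom(V, W)) : uq_hom (V := V) (W := W) f ->
  forall v, f (actKV V v) = actKV W (f v).
Proof.
case=> _ _ fK v; apply: (actK_inj N_odd W_mod).
by rewrite -fK (actKKV N_odd V_mod) (actKKV N_odd W_mod).
Qed.

End Homs.

(** * Maps commuting with multiplication by x, and their lifting *)

Section XAction.
Context {k : fieldType} {N : nat} {q : k}.
Hypotheses (N_odd : odd N) (q_prim : N.-primitive_root q).

(* What multiplication by x looks like on a module over k[x]/(x^N). *)
Record xaction (M : uqdata (k := k)) (r : 'End(M)) : Prop := XAction {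
  xact_E : forall m, actE M (r m) = q ^- 2 *: r (actE M m) + m;
  xact_F : forall m, actF M (r m) = r (actF M m) - q *: r (r (actKV M m));
  xact_K : forall m, actK M (r m) = q ^- 2 *: r (actK M m);
  xact_N : forall m, iter N r m = 0 }.

Lemma xact_KV (M : uqdata (k := k)) (r : 'End(M)) : uq_module N q M -> xaction r ->
  forall m, actKV M (r m) = q ^+ 2 *: r (actKV M m).
Proof.
move=> M_mod r_x m; apply: (actK_inj N_odd M_mod).
rewrite linearZ /= (xact_K r_x) !(actKKV N_odd M_mod) scalerA divff ?scale1r //.
by rewrite expf_neq0 // (q_neq0 N_odd q_prim).
Qed.

(** Hom_A(M, X) inside the internal Hom, presented as a kernel so as to be a subspace. *)
Definition xhom (M X : uqdata (k := k)) (r : 'End(M)) (s : 'End(X)) : {vspace uq_ihom M X} :=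
  lker (conj_lfun \1%VF r - conj_lfun s \1%VF).

Lemma xhomP (M X : uqdata (k := k)) (r : 'End(M)) (s : 'End(X)) (f : 'Hom(M, X)) :
  reflect (forall m, f (r m) = s (f m)) (f \in xhom r s).
Proof.
rewrite memv_ker add_lfunE opp_lfunE subr_eq0.
apply: (iffP eqP) => [/lfunP fr m|fr]; last apply/lfunP => m.
  by have := fr m; rewrite !conj_lfunE !id_lfunE.
by rewrite !conj_lfunE !id_lfunE.
Qed.

Section Stable.
Context {M X : uqdata (k := k)} {r : 'End(M)} {s : 'End(X)}.
Hypotheses (M_mod : uq_module N q M) (X_mod : uq_module N q X).
Hypotheses (r_x : xaction r) (s_x : xaction s).

Let q20 : q ^+ 2 != 0. Proof. by rewrite expf_neq0 // (q_neq0 N_odd q_prim). Qed.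

(** The inhomogeneous terms of the two relations for E contribute the same multiple of f(K^-1 m),
    with opposite signs. *)
Lemma xhom_actE f : f \in xhom r s -> actE (uq_ihom M X) f \in xhom r s.
Proof.
move=> /xhomP fr; apply/xhomP => m; rewrite !ihom_actE (xact_KV M_mod r_x) !linearZ /=.
rewrite fr !(xact_E r_x, xact_E s_x) !linearD !linearZ /= fr.
apply: coord_ext => i; rewrite !(linearB, linearD, linearN, linearZ) /=.
by field; rewrite (q_neq0 N_odd q_prim).
Qed.

(** Both halves of the action of F produce the quadratic term [q *: s (s (actKV X (f m)))], which
    cancels in the difference. *)
Lemma xhom_actF f : f \in xhom r s -> actF (uq_ihom M X) f \in xhom r s.
Proof.
move=> /xhomP fr; apply/xhomP => m; rewrite !ihom_actF fr (xact_F s_x).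
have -> : actK M (actF M (r m))
    = q ^- 2 *: r (actK M (actF M m)) - (q * (q ^- 2 * q ^- 2)) *: r (r m).
  rewrite (xact_F r_x) linearB linearZ /= (xact_K r_x) (xact_K r_x (r _)) (xact_K r_x).
  rewrite (actKKV N_odd M_mod) !linearZ /=.
  by apply: coord_ext => i; rewrite !(linearB, linearD, linearN, linearZ) /=; ring.
have -> : actKV X (f (q ^- 2 *: r (actK M (actF M m)) - (q * (q ^- 2 * q ^- 2)) *: r (r m)))
    = s (actKV X (f (actK M (actF M m)))) - q *: s (s (actKV X (f m))).
  rewrite !linearB !linearZ /= !fr (xact_KV X_mod s_x) (xact_KV X_mod s_x (s _)).
  rewrite (xact_KV X_mod s_x) !linearZ /=.
  apply: coord_ext => i; rewrite !(linearB, linearD, linearN, linearZ) /=.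
  by field; rewrite (q_neq0 N_odd q_prim).
by apply: coord_ext => i; rewrite !(linearB, linearD, linearN, linearZ) /=; ring.
Qed.

Lemma xhom_actK f : f \in xhom r s -> actK (uq_ihom M X) f \in xhom r s.
Proof.
move=> /xhomP fr; apply/xhomP => m; rewrite !ihom_actK (xact_KV M_mod r_x) !linearZ /=.
by rewrite fr (xact_K s_x) scalerA divff // scale1r.
Qed.

Lemma xhom_module : uq_module N q (uq_sub (xhom r s)).
Proof.
apply: uq_sub_module => //; [exact: xhom_actE | exact: xhom_actF | exact: xhom_actK |].
exact: uq_ihom_module.
Qed.

End Stable.

Lemma surj_lfunVK (V W : vectType k) (g : 'Hom(V, W)) : surj g -> cancel g^-1%VF g.
Proof.
by move=> gS w; apply: limg_lfunVK; have [v <-] := gS w; apply: memv_img (memvf v).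
Qed.

(** M is free over k[x]/(x^N) on the kernel of E, so it suffices to lift there: a merely linear
    section of [g] is applied to the Taylor coefficients, and powers of [r] become powers of [s]. *)
Lemma xhom_surj (M X Y : uqdata (k := k)) (r : 'End(M)) (s : 'End(X)) (t : 'End(Y))
    (g : 'Hom(X, Y)) :
    uq_module N q M -> xaction r -> xaction s -> surj g ->
    (forall x, g (s x) = t (g x)) ->
  forall f, f \in xhom r t -> exists2 f', f' \in xhom r s & (g \o f')%VF = f.
Proof.
move=> M_mod r_x s_x gS gs f /xhomP fr.
have Qp : N.-primitive_root (q ^- 2) := prim_rootV N_odd (q2_prim N_odd q_prim).
(* Q = q^-2 is a primitive N-th root of unity, so the q-integers [n] with 0 < n < N are
   invertible. *)
have qint0 n : (0 < n < N)%N -> qint (Q := q ^- 2) n != 0.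
  move=> nN; apply: contraNneq (prim_expr_neq1 Qp nN) => n0.
  by rewrite -subr_eq0 subrX1 [X in _ * X]n0 mulr0.
pose lift := @taylor_lift k M N (q ^- 2) (actE M) r X s (g^-1 \o f)%VF.
have liftL : linear lift by apply: taylor_lift_linear.
exists (linfun lift).
  apply/xhomP => m; rewrite !linfunE //.
  exact: (taylor_lift_r (xact_E r_x) (xact_N r_x) qint0 _ _ (xact_N s_x)).
apply/lfunP => m; rewrite comp_lfunE linfunE //.
rewrite -[in RHS](taylor (xact_E r_x) (xact_N r_x) (uq_EN M_mod) qint0 m).
rewrite /lift /taylor_lift !linear_sum; apply: eq_bigr => i _; rewrite !linearZ /=.
congr (_ *: _); rewrite comp_lfunE id_lfunE.
move: (ker_proj _) => u; elim: (nat_of_ord i) => [|n IH] /=; first by rewrite surj_lfunVK.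
by rewrite gs IH fr.
Qed.

Section Lift.
Context {P M X Y : uqdata (k := k)}.
Context {r : 'End(M)} {s : 'End(X)} {t : 'End(Y)}.
Hypotheses (M_mod : uq_module N q M) (X_mod : uq_module N q X) (Y_mod : uq_module N q Y).
Hypotheses (r_x : xaction r) (s_x : xaction s) (t_x : xaction t).

Definition xpush (g : 'Hom(X, Y)) : 'Hom(uq_sub (xhom r s), uq_sub (xhom r t)) :=
  linfun (vsproj (xhom r t) \o conj_lfun g \1%VF \o vsval).

Lemma xpushE (g : 'Hom(X, Y)) (f : uq_sub (xhom r s)) : (forall x, g (s x) = t (g x)) ->
  vsval (xpush g f) = (g \o vsval f)%VF.
Proof.
move=> gs; rewrite /xpush lfunE /= vsprojK.
  by apply/lfunP => m; rewrite conj_lfunE comp_lfunE id_lfunE.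
apply/xhomP => m; rewrite !conj_lfunE !id_lfunE -gs.
by have /xhomP -> := subvsP f.
Qed.

Lemma xpush_hom (g : 'Hom(X, Y)) : (forall x, g (s x) = t (g x)) ->
  uq_hom (V := X) (W := Y) g ->
  uq_hom (V := uq_sub (xhom r s)) (W := uq_sub (xhom r t)) (xpush g).
Proof.
move=> gs gH; have [gE gF gK] := gH; have gKV := uq_hom_actKV N_odd X_mod Y_mod gH.
split=> f; apply: val_inj; apply/lfunP => m /=.
- rewrite xpushE // (vsval_actE (xhom_actE M_mod r_x s_x)).
  rewrite (vsval_actE (xhom_actE M_mod r_x t_x)).
  by rewrite comp_lfunE !ihom_actE xpushE // !comp_lfunE linearB /= gE.
- rewrite xpushE // (vsval_actF (xhom_actF M_mod X_mod r_x s_x)).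
  rewrite (vsval_actF (xhom_actF M_mod Y_mod r_x t_x)).
  by rewrite comp_lfunE !ihom_actF xpushE // !comp_lfunE linearB /= gF gKV.
- rewrite xpushE // (vsval_actK (xhom_actK M_mod r_x s_x)).
  rewrite (vsval_actK (xhom_actK M_mod r_x t_x)).
  by rewrite comp_lfunE !ihom_actK xpushE // !comp_lfunE gK.
Qed.

Lemma xpush_surj (g : 'Hom(X, Y)) : (forall x, g (s x) = t (g x)) -> surj g -> surj (xpush g).
Proof.
move=> gs gS f.
have [f' f'r gf'] := xhom_surj M_mod r_x s_x gS gs (subvsP f).
exists (vsproj (xhom r s) f'); apply: val_inj.
by rewrite /= xpushE //= vsprojK.
Qed.

(** One half of the adjunction Hom_A(P (x) M, Y) = Hom(P, Hom_A(M, Y)); [xuncurry] is the other. *)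
Definition xcurry (f : 'Hom(uq_tens P M, Y)) : 'Hom(P, uq_sub (xhom r t)) :=
  linfun (fun p => vsproj (xhom r t) (f \o linfun (tensv p))%VF).

Lemma xcurryE (f : 'Hom(uq_tens P M, Y)) p m :
    (forall p m, f (p \ox r m) = t (f (p \ox m))) ->
  (vsval (xcurry f p) : 'Hom(M, Y)) m = f (p \ox m).
Proof.
move=> fr; rewrite /xcurry linfunE => [|c p1 p2].
  rewrite vsprojK ?comp_lfunE ?lfunE //.
  by apply/xhomP => m'; rewrite !comp_lfunE !lfunE /= fr.
rewrite -linearP; congr vsproj; apply/lfunP => m'.
by rewrite !(add_lfunE, scale_lfunE, comp_lfunE, lfunE) /= tensvDl tensvZl linearP.
Qed.

Lemma xcurry_hom (f : 'Hom(uq_tens P M, Y)) : uq_module N q P ->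
    (forall p m, f (p \ox r m) = t (f (p \ox m))) ->
  uq_hom (V := uq_tens P M) (W := Y) f ->
  uq_hom (V := P) (W := uq_sub (xhom r t)) (xcurry f).
Proof.
move=> P_mod fr fH; have [fE fF fK] := fH.
have PM_mod := uq_tens_module N_odd q_prim P_mod M_mod.
have fKV := uq_hom_actKV N_odd PM_mod Y_mod fH.
split=> p; apply: val_inj; apply/lfunP => m /=.
- rewrite (vsval_actE (xhom_actE M_mod r_x t_x)).
  rewrite ihom_actE !xcurryE // -fE tens_actE (actKKV N_odd M_mod).
  by rewrite linearD /= addrK.
- rewrite (vsval_actF (xhom_actF M_mod Y_mod r_x t_x)).
  rewrite ihom_actF !xcurryE // -fF -fKV tens_actF (tens_actKV N_odd P_mod M_mod).
  by rewrite (actKVK N_odd M_mod) linearD /= addrK.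
- rewrite (vsval_actK (xhom_actK M_mod r_x t_x)).
  by rewrite ihom_actK !xcurryE // -fK tens_actK (actKKV N_odd M_mod).
Qed.

Definition xuncurry (f : 'Hom(P, uq_sub (xhom r s))) : 'Hom(uq_tens P M, X) :=
  tens_lift (fun (p : P) (m : M) => (vsval (f p) : 'Hom(M, X)) m).

Lemma xuncurryE (f : 'Hom(P, uq_sub (xhom r s))) p m :
  xuncurry f (p \ox m) = (vsval (f p) : 'Hom(M, X)) m.
Proof.
rewrite /xuncurry tens_liftE // => [m'|p'] c x y; last by rewrite linearP.
by rewrite !linearP /= add_lfunE scale_lfunE.
Qed.

Lemma xuncurry_hom (f : 'Hom(P, uq_sub (xhom r s))) : uq_module N q P ->
  uq_hom (V := P) (W := uq_sub (xhom r s)) f ->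
  uq_hom (V := uq_tens P M) (W := X) (xuncurry f).
Proof.
move=> P_mod fH; have [fE fF fK] := fH.
have H_mod := xhom_module M_mod X_mod r_x s_x.
have fKV := uq_hom_actKV N_odd P_mod H_mod fH.
have HE := xhom_actE M_mod r_x s_x.
have HF := xhom_actF M_mod X_mod r_x s_x.
have HK := xhom_actK M_mod r_x s_x.
have I_mod := uq_ihom_module N_odd q_prim M_mod X_mod.
split=> u; rewrite -!comp_lfunE; congr (fun_of_lfun _ u); apply: tens_ext => p m.
- rewrite !comp_lfunE tens_actE linearD /= !xuncurryE fE vsval_actE //.
  by rewrite ihom_actE (actKVK N_odd M_mod) subrK.
- rewrite !comp_lfunE tens_actF linearD /= !xuncurryE fF vsval_actF // fKV.
  by rewrite (vsval_actKV N_odd HK I_mod) ihom_actF (ihom_actKV N_odd M_mod X_mod) subrK.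
- by rewrite !comp_lfunE tens_actK !xuncurryE fK vsval_actK // ihom_actK (actKVK N_odd M_mod).
Qed.

(** The map [f] is curried, lifted through the surjection [xpush g] by projectivity of [P], and
    uncurried. *)
Lemma xaction_lift (g : 'Hom(X, Y)) (f : 'Hom(uq_tens P M, Y)) :
    uq_projective N q P ->
    uq_hom (V := X) (W := Y) g -> surj g -> (forall x, g (s x) = t (g x)) ->
    uq_hom (V := uq_tens P M) (W := Y) f ->
    (forall p m, f (p \ox r m) = t (f (p \ox m))) ->
  exists f' : 'Hom(uq_tens P M, X), [/\ uq_hom (V := uq_tens P M) (W := X) f',
    forall p m, f' (p \ox r m) = s (f' (p \ox m)) & (g \o f')%VF = f].
Proof.
move=> [P_mod P_lift] gH gS gs fH fr.
have [f0 f0H f0E] := P_lift _ _ _ _ (xhom_module M_mod X_mod r_x s_x)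
  (xhom_module M_mod Y_mod r_x t_x) (xpush_hom gs gH) (xpush_surj gs gS)
  (xcurry_hom P_mod fr fH).
exists (xuncurry f0); split; first exact: xuncurry_hom.
  by move=> p m; rewrite !xuncurryE; have /xhomP -> := subvsP (f0 p).
apply: tens_ext => p m; rewrite comp_lfunE xuncurryE -(xcurryE _ _ fr) -f0E.
by rewrite comp_lfunE xpushE // comp_lfunE.
Qed.

End Lift.

End XAction.

(** * Truncated polynomials and their monomial basis *)

Section TruncatedPoly.
Context {k : fieldType} {N : nat}.
Hypothesis N_gt1 : (1 < N)%N.

Local Notation T := {poly %/ ('X^N : {poly k})}.
Local Notation x := ('qX : T).

(** The quotient construction passes its modulus through [mk_monic], which leaves ['X^N] unchanged
    for N > 0. *)
Let mkX : mk_monic ('X^N : {poly k}) = 'X^N.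
Proof. by rewrite mk_monic_Xn prednK // ltnW. Qed.

Lemma tpolyX_exp n : x ^+ n = in_qpoly 'X^N 'X^n.
Proof. by rewrite /qpolyX -rmorphXn. Qed.

Lemma tpolyX_nil n : (N <= n)%N -> x ^+ n = 0.
Proof.
move=> Nn; rewrite tpolyX_exp; apply: val_inj => /=; rewrite mkX.
by rewrite -(subnK Nn) exprD Pdiv.RingMonic.rmodp_mull ?monicXn.
Qed.

Lemma val_tpolyX n : (n < N)%N -> (x ^+ n : {poly k}) = 'X^n.
Proof. by move=> nN; rewrite tpolyX_exp in_qpoly_small // mkX !size_polyXn. Qed.

Lemma tpoly_expand (a : T) : a = \sum_(i < N) (a : {poly k})`_i *: x ^+ i.
Proof.
have sa : (size (a : {poly k}) <= N)%N.
  have sN : size (mk_monic ('X^N : {poly k})) = N.+1 by rewrite mkX size_polyXn.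
  by rewrite -ltnS -sN size_mk_monic.
have {1}-> : a = in_qpoly 'X^N (a : {poly k}).
  by apply/esym/val_inj/in_qpoly_small/size_mk_monic.
have {1}-> : (a : {poly k}) = \sum_(i < N) (a : {poly k})`_i *: 'X^i.
  rewrite -poly_def; apply/polyP => i; rewrite coef_poly.
  by case: ltnP => // /(leq_trans sa) /leq_sizeP ->.
by rewrite linear_sum; apply: eq_bigr => i _; rewrite linearZ /= tpolyX_exp.
Qed.

Lemma tpoly_ext (U : vectType k) (f g : @tpoly k N -> U) : linear f -> linear g ->
  (forall n, (n < N)%N -> f (x ^+ n) = g (x ^+ n)) -> f =1 g.
Proof.
move=> fL gL fg a; rewrite -(linfunE fL) -(linfunE gL).
rewrite [a]tpoly_expand !linear_sum; apply: eq_bigr => i _.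
by rewrite !linearZ /= !linfunE // fg.
Qed.

Lemma tpoly_tens_ext (U : vectType k) (f g : 'Hom(tens (@tpoly k N) (@tpoly k N), U)) :
    (forall m n, (m < N)%N -> (n < N)%N ->
       f ((x ^+ m : tpoly N) \ox (x ^+ n : tpoly N))
       = g ((x ^+ m : tpoly N) \ox (x ^+ n : tpoly N))) ->
  f = g.
Proof.
move=> fg; apply: tens_ext => a b.
apply: (@tpoly_ext _ (fun a => f (a \ox b)) (fun a => g (a \ox b))) a.
- by move=> c u v; rewrite tensvDl tensvZl linearP.
- by move=> c u v; rewrite tensvDl tensvZl linearP.
move=> m mN; apply: (@tpoly_ext _ (fun b => f (_ \ox b)) (fun b => g (_ \ox b))) b.
- by move=> c u v; rewrite !linearP.
- by move=> c u v; rewrite !linearP.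
by move=> n nN; apply: fg.
Qed.

Definition tcoef n (a : T) : k^o := (a : {poly k})`_n.

Lemma tcoef_linear n : linear (tcoef n : @tpoly k N -> k^o).
Proof. by move=> c a b; rewrite /tcoef /= coefD coefZ. Qed.

HB.instance Definition _ n :=
  GRing.isLinear.Build k (@tpoly k N) k^o _ (tcoef n) (tcoef_linear n).

Lemma tcoefX n m : (m < N)%N -> tcoef n (x ^+ m) = (n == m)%:R.
Proof. by move=> mN; rewrite /tcoef val_tpolyX // coefXn. Qed.

End TruncatedPoly.

(** * Existence and uniqueness of the action on truncated polynomials *)

Section TruncatedAction.
Context {k : fieldType} {N : nat} {q : k}.
Hypotheses (N_odd : odd N) (N_gt1 : (1 < N)%N) (q_prim : N.-primitive_root q).

Local Notation T := {poly %/ ('X^N : {poly k})}.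
Local Notation x := ('qX : T).

Lemma tpoly_mulE (act : uqops (@tpoly k N)) (a b : T) :
  amul (tpoly_alg act) ((a : @tpoly k N) \ox (b : @tpoly k N)) = a * b.
Proof.
rewrite /tpoly_alg /= tens_liftE // => [w|v] c u u'.
  by rewrite mulrDl scalerAl.
by rewrite mulrDr scalerAr.
Qed.

Lemma tpoly_unitE (act : uqops (@tpoly k N)) (c : k) :
  aunit (tpoly_alg act) (c : k^o) = c *: (1 : T).
Proof. by rewrite /= linfunE // => d u v; rewrite scalerDl scalerA. Qed.

(** Required for all n, so that the formulas also carry the compatibility with x^N = 0. *)
Definition tpoly_basis_ops (act : uqops (@tpoly k N)) : Prop :=
  [/\ forall n, opE act (x ^+ n) = qint (Q := q ^- 2) n *: x ^+ n.-1,
      forall n, opF act (x ^+ n) = (- q * qint (Q := q ^+ 2) n) *: x ^+ n.+1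
    & forall n, opK act (x ^+ n) = (q ^- 2) ^+ n *: x ^+ n].

Lemma uqops_eq (V : vectType k) (a b : uqops V) :
  opE a =1 opE b -> opF a =1 opF b -> opK a =1 opK b -> a = b.
Proof.
by case: a b => [aE aF aK] [bE bF bK] /= /lfunP -> /lfunP -> /lfunP ->.
Qed.

Lemma tpoly_basis_ops_inj (a b : uqops (@tpoly k N)) :
  tpoly_basis_ops a -> tpoly_basis_ops b -> a = b.
Proof.
move=> [aE aF aK] [bE bF bK]; apply: uqops_eq.
- by apply: (tpoly_ext N_gt1) => [||n _]; try exact: linearP; rewrite aE bE.
- by apply: (tpoly_ext N_gt1) => [||n _]; try exact: linearP; rewrite aF bF.
- by apply: (tpoly_ext N_gt1) => [||n _]; try exact: linearP; rewrite aK bK.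
Qed.

Section FromAction.
Variable act : uqops (@tpoly k N).
Hypothesis act_x : tpoly_action q act.
Local Notation A := (tpoly_alg act).

Let A_alg : uq_algebra N q A. Proof. by case: act_x. Qed.
Let A_mod : uq_module N q A := alg_module A_alg.

(** Equivariance of the product, read through the coproduct, is a skew Leibniz rule; likewise for F
    and K. *)
Lemma tact_mulE (a b : T) :
  actE A (a * b) = (actE A a : T) * (actK A b : T) + a * (actE A b : T).
Proof.
have [H _ _] := amul_hom A_alg.
by rewrite -(tpoly_mulE act) -H tens_actE linearD /= !tpoly_mulE.
Qed.

Lemma tact_mulF (a b : T) :
  actF A (a * b) = (actF A a : T) * b + (actKV A a : T) * (actF A b : T).
Proof.
have [_ H _] := amul_hom A_alg.
by rewrite -(tpoly_mulE act) -H tens_actF linearD /= !tpoly_mulE.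
Qed.

Lemma tact_mulK (a b : T) : actK A (a * b) = (actK A a : T) * (actK A b : T).
Proof.
have [_ _ H] := amul_hom A_alg.
by rewrite -(tpoly_mulE act) -H tens_actK tpoly_mulE.
Qed.

Lemma tact_unit : [/\ actE A (1 : T) = 0, actF A (1 : T) = 0 & actK A (1 : T) = 1].
Proof.
have [HE HF HK] := aunit_hom A_alg.
have u1 : aunit A (1 : k^o) = (1 : T) by rewrite tpoly_unitE scale1r.
split; rewrite -u1.
- by rewrite -HE /actE /= zero_lfunE linear0.
- by rewrite -HF /actF /= zero_lfunE linear0.
- by rewrite -HK /actK /= id_lfunE.
Qed.

Lemma tact_KX n : actK A (x ^+ n) = (q ^- 2) ^+ n *: x ^+ n.
Proof.
have [_ Kx _ _] := act_x; have [_ _ K1] := tact_unit.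
elim: n => [|n IH]; first by rewrite K1 scale1r.
by rewrite [x ^+ _]exprS tact_mulK IH /actK /= Kx -scalerAl -scalerAr scalerA -!exprS.
Qed.

Lemma tact_KVX n : actKV A (x ^+ n) = (q ^+ 2) ^+ n *: x ^+ n.
Proof.
apply: (actK_inj N_odd A_mod); rewrite (actKKV N_odd A_mod) linearZ /= tact_KX scalerA.
by rewrite -exprMn divff ?expr1n ?scale1r // expf_neq0 // (q_neq0 N_odd q_prim).
Qed.

(** Since x generates A, the images of x determine the action, by induction along the skew Leibniz
    rules. *)
Lemma tpoly_actionE : tpoly_basis_ops act.
Proof.
have [_ Kx Ex Fx] := act_x; have [E1 F1 K1] := tact_unit.
split=> n; last exact: tact_KX.
- elim: n => [|n IH]; first by rewrite /qint big_ord0 scale0r -[RHS]E1.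
  rewrite exprSr -[LHS]/(actE A _) tact_mulE -[actE A (x ^+ n)]/(opE act _) IH.
  rewrite /actK /= Kx /actE /= Ex mulr1 -scalerAl -scalerAr scalerA qintS mulrC.
  (* At n = 0 the exponent [n.-1] is truncated, but its coefficient [qint 0] vanishes. *)
  case: n {IH} => [|n]; first by rewrite /qint big_ord0 mulr0 scale0r add0r addr0 scale1r.
  by rewrite -exprSr -[X in _ + X]scale1r -scalerDl addrC.
- elim: n => [|n IH]; first by rewrite /qint big_ord0 mulr0 scale0r -[RHS]F1.
  rewrite exprS -[LHS]/(actF A _) tact_mulF -[actF A (x ^+ n)]/(opF act _) IH.
  have -> : actKV A x = q ^+ 2 *: x by have := tact_KVX 1; rewrite !expr1.
  rewrite /actF /= Fx -!scalerAl -scalerAr scalerA -exprD -exprS add2n.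
  by rewrite -scalerDl qintS; congr (_ *: _); ring.
Qed.

End FromAction.
Let q0 : q != 0 := q_neq0 N_odd q_prim.

Lemma q2_neq1 : q ^+ 2 != 1.
Proof. exact: (prim_expr_neq1 (q2_prim N_odd q_prim) (i := 1)). Qed.

Lemma q2_sub1_neq0 : q ^+ 2 - 1 != 0.
Proof. by rewrite subr_eq0 q2_neq1. Qed.

Lemma qint_q2 n : qint (Q := q ^+ 2) n = ((q ^+ n) ^+ 2 - 1) / (q ^+ 2 - 1).
Proof.
apply: (mulIf q2_sub1_neq0); rewrite divfK ?q2_sub1_neq0 // mulrC.
by rewrite -subrX1 exprAC.
Qed.

Lemma qint_q2V n : qint (Q := q ^- 2) n = (1 - (q ^+ n) ^- 2) / (1 - q ^- 2).
Proof.
have qV : 1 - q ^- 2 != 0 by rewrite subr_eq0 eq_sym invr_eq1 q2_neq1.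
apply: (mulIf qV); rewrite divfK // mulrC -[LHS]opprK -mulNr opprB.
by rewrite -subrX1 opprB exprVn exprAC.
Qed.

(** E would send x^N to [N] x^(N-1); the vanishing of [N] lets it descend to the quotient by x^N. *)
Lemma qint_q2V_N : qint (Q := q ^- 2) N = 0.
Proof. by rewrite qint_q2V (prim_expr_order q_prim) expr1n invr1 subrr mul0r. Qed.

Definition tpoly_lin (c : nat -> T) : 'End(@tpoly k N) :=
  linfun (fun a : @tpoly k N => \sum_(i < N) tcoef i a *: c i : @tpoly k N).

Lemma tpoly_linX c n : (n < N)%N -> tpoly_lin c (x ^+ n) = c n.
Proof.
move=> nN; rewrite /tpoly_lin linfunE => [|d a b].
  rewrite (bigD1 (Ordinal nN)) //= (tcoefX N_gt1) // eqxx scale1r big1 ?addr0 // => i.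
  by rewrite -val_eqE /= (tcoefX N_gt1) // => /negPf ->; rewrite scale0r.
rewrite scaler_sumr -big_split; apply: eq_bigr => i _ /=.
by rewrite linearP scalerDl scalerA.
Qed.

Definition tpoly_ops : uqops (@tpoly k N) := UqOps
  (tpoly_lin (fun n => qint (Q := q ^- 2) n *: x ^+ n.-1))
  (tpoly_lin (fun n => (- q * qint (Q := q ^+ 2) n) *: x ^+ n.+1))
  (tpoly_lin (fun n => (q ^- 2) ^+ n *: x ^+ n)).

Lemma tpoly_opsE : tpoly_basis_ops tpoly_ops.
Proof.
split=> n /=; have [nN|Nn] := ltnP n N; first [by rewrite tpoly_linX |
  rewrite [x ^+ n](tpolyX_nil N_gt1) // linear0].
(* Only n = N is delicate, since x^(N-1) is nonzero; there the coefficient vanishes. *)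
- have [->|nN] := eqVneq n N; first by rewrite qint_q2V_N scale0r.
  rewrite (tpolyX_nil N_gt1) ?scaler0 // -ltnS (leq_trans _ (leqSpred _)) // ltn_neqAle eq_sym nN.
  exact: Nn.
- by rewrite (tpolyX_nil N_gt1) ?scaler0 // ltnW.
- by rewrite scaler0.
Qed.

Section FromOps.
Variable act : uqops (@tpoly k N).
Hypothesis act_ops : tpoly_basis_ops act.
Local Notation A := (tpoly_alg act).

Lemma tops_E n : actE A (x ^+ n) = qint (Q := q ^- 2) n *: x ^+ n.-1.
Proof. by case: act_ops. Qed.

Lemma tops_F n : actF A (x ^+ n) = (- q * qint (Q := q ^+ 2) n) *: x ^+ n.+1.
Proof. by case: act_ops. Qed.

Lemma tops_K n : actK A (x ^+ n) = (q ^- 2) ^+ n *: x ^+ n.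
Proof. by case: act_ops. Qed.

Lemma iter_tops_E m n : iter m (actE A) (x ^+ n) =
  (\prod_(i < m) qint (Q := q ^- 2) (n - i)) *: x ^+ (n - m).
Proof.
elim: m => [|m IH] /=; first by rewrite big_ord0 scale1r subn0.
by rewrite IH linearZ /= tops_E scalerA big_ord_recr subnS.
Qed.

Lemma iter_tops_F m n : iter m (actF A) (x ^+ n) =
  (\prod_(i < m) (- q * qint (Q := q ^+ 2) (n + i))) *: x ^+ (n + m).
Proof.
elim: m => [|m IH] /=; first by rewrite big_ord0 scale1r addn0.
by rewrite IH linearZ /= tops_F scalerA big_ord_recr addnS.
Qed.

Lemma iter_tops_K m n : iter m (actK A) (x ^+ n) = ((q ^- 2) ^+ n) ^+ m *: x ^+ n.
Proof.
elim: m => [|m IH] /=; first by rewrite scale1r.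
by rewrite IH linearZ /= tops_K scalerA -exprSr.
Qed.

Let ext (f g : A -> A) := @tpoly_ext k N N_gt1 A f g.

Lemma tops_KN a : iter N (actK A) a = a.
Proof.
apply: (@ext _ id) a => [||n _]; first exact: iter_linear; first by [].
rewrite iter_tops_K exprAC exprVn exprAC (prim_expr_order q_prim).
by rewrite expr1n invr1 expr1n scale1r.
Qed.

Lemma tops_KV n : actKV A (x ^+ n) = (q ^+ 2) ^+ n *: x ^+ n.
Proof.
have K_inj := iter_id_inj (odd_gt0 N_odd) tops_KN.
apply: (K_inj); rewrite /actKV lker0_lfunVK; last exact/lker0P.
rewrite linearZ /= tops_K scalerA -exprMn divff ?expr1n ?scale1r //.
by rewrite expf_neq0.
Qed.

Lemma tops_module : uq_module N q A.
Proof.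
have q20 : q ^+ 2 != 0 by rewrite expf_neq0.
split=> a.
- exact: tops_KN.
- apply: (@ext _ (fun=> 0)) a => [||n nN].
  + exact: iter_linear.
  + by move=> c u v; rewrite scaler0 addr0.
  (* For n < N the product giving E^N x^n contains the factor [qint 0], at i = n. *)
  + rewrite iter_tops_E (bigD1 (Ordinal nN)) //= subnn /qint big_ord0.
    by rewrite mul0r scale0r.
- apply: (@ext _ (fun=> 0)) a => [||n nN].
  + exact: iter_linear.
  + by move=> c u v; rewrite scaler0 addr0.
  + by rewrite iter_tops_F (tpolyX_nil N_gt1) ?scaler0 // leq_addl.
- rewrite -!comp_lfunE -scale_lfunE.
  apply: ext a => [||n _]; try exact: linearP.
  rewrite scale_lfunE !comp_lfunE tops_E tops_K !linearZ /= tops_K tops_E !scalerA.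
  case: n => [|n]; first by rewrite /qint big_ord0 !(mul0r, mulr0) !scale0r.
  by congr (_ *: _); rewrite mulrC /= [(q ^- 2) ^+ n.+1]exprSr divfK.
- rewrite -!comp_lfunE -scale_lfunE.
  apply: ext a => [||n _]; try exact: linearP.
  rewrite scale_lfunE !comp_lfunE tops_F tops_K !linearZ /= tops_K tops_F !scalerA.
  by congr (_ *: _); rewrite [(q ^- 2) ^+ n.+1]exprS; ring.
- rewrite -!comp_lfunE -!(add_lfunE, opp_lfunE, scale_lfunE).
  apply: ext a => [||n _]; try exact: linearP.
  rewrite [LHS]add_lfunE [X in _ + X = _]opp_lfunE [RHS]scale_lfunE.
  rewrite [X in _ = _ *: X]add_lfunE [X in _ = _ *: (_ + X)]opp_lfunE.
  rewrite !comp_lfunE tops_E tops_F tops_K tops_KV !linearZ /= tops_E tops_F !scalerA !scalerN.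
  case: n => [|n].
    by rewrite /qint !big_ord0 !(mul0r, mulr0) !scale0r !expr0 !scale1r !subrr scaler0.
  rewrite /= ?scalerA -[LHS]scalerBl -[X in _ = _ *: X]scalerBl scalerA; congr (_ *: _).
  rewrite !qint_q2 !qint_q2V exprVn.
  rewrite ![(q ^+ 2) ^+ _]exprAC !exprS.
  have := expf_neq0 n q0; move: (q ^+ n) => u u0.
  by field; rewrite q0 u0 -expr2 q2_sub1_neq0.
Qed.

(** On x^m (x) x^n equivariance becomes an identity between q-integers, such as [m] Q^n + [n] =
    [m+n] with Q = q^-2 for E. *)
Lemma tops_algebra : uq_algebra N q A.
Proof.
split.
- exact: tops_module.
- split=> u; rewrite -!comp_lfunE; congr (fun_of_lfun _ u);
    apply: (tpoly_tens_ext N_gt1) => m n _ _; rewrite !comp_lfunE.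
  + rewrite (@tens_actE _ A A) linearD /= !tops_E tops_K !tensvZl !tensvZr !linearZ /=.
    rewrite !(tpoly_mulE act) -!exprD tops_E !scalerA.
    (* The cases m = 0 and n = 0 are separated because the exponents [m.-1] and [n.-1] are truncated
       there. *)
    case: m => [|m].
      by rewrite /qint big_ord0 mul0r scale0r !add0r add0n.
    rewrite addSn; case: n => [|n].
      by rewrite expr0 mulr1 [qint 0]big_ord0 scale0r !addr0 !addn0.
    rewrite /= addSn addnS -scalerDl; congr (_ *: _).
    rewrite !qint_q2V !exprVn ![(q ^+ 2) ^+ _]exprAC !(exprS, exprD).
    have := expf_neq0 n q0; have := expf_neq0 m q0.
    move: (q ^+ n) (q ^+ m) => u' v' u0 v0.
    by field; rewrite q0 u0 v0 -expr2 q2_sub1_neq0.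
  + rewrite (@tens_actF _ A A) linearD /= !tops_F tops_KV !tensvZl !tensvZr !linearZ /=.
    rewrite !(tpoly_mulE act) -!exprD tops_F !scalerA addSn addnS -scalerDl; congr (_ *: _).
    rewrite !qint_q2 ![(q ^+ 2) ^+ _]exprAC !exprD.
    move: (q ^+ n) (q ^+ m) => u' v'.
    by field; rewrite q2_sub1_neq0.
  + rewrite (@tens_actK _ A A) !tops_K !tensvZl !tensvZr !linearZ /=.
    by rewrite !(tpoly_mulE act) -!exprD tops_K !scalerA -exprD addnC.
- have [E1 F1 K1] : [/\ actE A (1 : T) = 0, actF A (1 : T) = 0 & actK A (1 : T) = 1].
    split.
    + by have := tops_E 0; rewrite /qint big_ord0 scale0r.
    + by have := tops_F 0; rewrite /qint big_ord0 mulr0 scale0r.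
    + by have := tops_K 0; rewrite !expr0 scale1r.
  split=> c; rewrite !tpoly_unitE linearZ /= ?E1 ?F1 ?K1.
  + by rewrite /actE /= zero_lfunE scale0r scaler0.
  + by rewrite /actF /= zero_lfunE scale0r scaler0.
  + by rewrite /actK /= id_lfunE.
- by move=> a b c; rewrite !tpoly_mulE mulrA.
- by move=> a; rewrite tpoly_unitE tpoly_mulE scale1r mul1r.
- by move=> a; rewrite tpoly_unitE tpoly_mulE scale1r mulr1.
Qed.

Lemma tops_action : tpoly_action q act.
Proof.
split; first exact: tops_algebra.
- by have := tops_K 1; rewrite !expr1.
- by have := tops_E 1; rewrite !expr1 /qint big_ord1 scale1r.
- by have := tops_F 1; rewrite !expr1 /qint big_ord1 mulr1.
Qed.

End FromOps.

Lemma tpoly_action_exists_unique :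
  exists! act : uqops (@tpoly k N), tpoly_action q act.
Proof.
exists tpoly_ops; split; first exact: tops_action tpoly_opsE.
by move=> act /tpoly_actionE; apply: tpoly_basis_ops_inj; exact: tpoly_opsE.
Qed.

End TruncatedAction.

(** * Haploidity and exactness *)

Section Exactness.
Context {k : fieldType} {N : nat} {q : k}.
Hypotheses (N_odd : odd N) (N_gt1 : (1 < N)%N) (q_prim : N.-primitive_root q).

Local Notation T := {poly %/ ('X^N : {poly k})}.
Local Notation x := ('qX : T).

Variable act : uqops (@tpoly k N).
Hypothesis act_x : tpoly_action q act.
Local Notation A := (tpoly_alg act).

Let A_ops : tpoly_basis_ops (q := q) act. Proof. exact: tpoly_actionE. Qed.

Lemma tcoef_K n (a : T) : tcoef n (actK A a) = (q ^- 2) ^+ n *: tcoef n a.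
Proof.
apply: (@tpoly_ext _ _ N_gt1 k^o (fun a => tcoef n (actK A a))
          (fun a => (q ^- 2) ^+ n *: tcoef n a)) a.
- by move=> c u v; rewrite !linearP.
- by move=> c u v; rewrite !linearP.
move=> m mN; rewrite (tops_K A_ops) linearZ /= (tcoefX N_gt1) //.
by case: eqVneq => [->|_]; rewrite ?scaler0.
Qed.

(** The image of 1 is fixed by K, and K acts on x^n by q^(-2n), which differs from 1 for 0 < n < N.
    Only multiples of the unit remain. *)
Lemma tpoly_haploid : haploid_alg A.
Proof.
pose F (c : k^o) : 'Hom(uq_unit, A) := c *: aunit A.
have FL : linear F by move=> c u v; rewrite /F scalerDl scalerA.
have one0 : (1 : T) != 0 by exact: oner_neq0.
exists (linfun F) => [c d|f].
  rewrite !linfunE // => /lfunP /(_ (1 : k^o)).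
  rewrite !scale_lfunE tpoly_unitE scale1r => /eqP.
  by rewrite -subr_eq0 -scalerBl scaler_eq0 (negPf one0) orbF subr_eq0 => /eqP.
split=> [[_ _ fK]|[c ->]]; last first.
  have [[_ _ aH _ _ _] _ _ _] := act_x; have [aE aF aK] := aH.
  have Fd d : linfun F c d = c *: aunit A d by rewrite linfunE // scale_lfunE.
  by split=> d; rewrite !Fd; [rewrite aE|rewrite aF|rewrite aK]; rewrite -linearZ.
pose a : T := f (1 : k^o).
have Ka : actK A a = a by rewrite -fK /actK /= id_lfunE.
have a0 n : (0 < n < N)%N -> tcoef n a = 0.
  move=> nN; have := tcoef_K n a; rewrite Ka => /eqP.
  rewrite -subr_eq0 -{1}[tcoef n a]scale1r -scalerBl scaler_eq0 subr_eq0 eq_sym.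
  have /negPf -> := prim_expr_neq1 (prim_rootV N_odd (q2_prim N_odd q_prim)) nN.
  by move/eqP.
exists (tcoef 0 a); apply/lfunP => c; rewrite linfunE // scale_lfunE tpoly_unitE.
have -> : f c = c *: a by rewrite -linearZ /=; congr (f _); rewrite /= [RHS]mulr1.
rewrite scalerA mulrC -scalerA; congr (_ *: _).
rewrite [LHS](tpoly_expand N_gt1) (bigD1 (Ordinal (ltnW N_gt1))) //= big1 ?addr0 // => i i0.
rewrite -[X in X *: _]/(tcoef i a) a0 ?scale0r //.
by rewrite ltn_ord lt0n -val_eqE /= in i0 *; rewrite andbT.
Qed.

Section XOperator.
Context {M : rmoddata A}.
Hypothesis M_rmod : rmodule N q M.

Definition xop : 'End(M) := linfun (fun m : M => ract M (m \ox (x : A))).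

Lemma xopE m : xop m = ract M (m \ox (x : A)).
Proof. by rewrite /xop linfunE // => c u v; rewrite tensvDl tensvZl linearP. Qed.

Lemma iter_xop n m : iter n xop m = ract M (m \ox (x ^+ n : A)).
Proof.
elim: n => [|n IH] /=.
  by have := ract1 M_rmod m; rewrite tpoly_unitE scale1r => ->.
by rewrite IH xopE (ractA M_rmod) tpoly_mulE -exprSr.
Qed.

(** Equivariance of the right action at m (x) x, combined with the values of E, F and K on x. *)
Lemma xop_xaction : xaction (N := N) (q := q) xop.
Proof.
have [HE HF HK] := ract_hom M_rmod.
have M1 m : ract M (m \ox (1 : T)) = m := esym (iter_xop 0 m).
have x1 : x = x ^+ 1 by [].
split=> m; last by rewrite iter_xop (tpolyX_nil N_gt1) // tensv0r linear0.
- rewrite !xopE -HE tens_actE linearD /= x1 (tops_E A_ops) (tops_K A_ops).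
  by rewrite /qint big_ord1 !expr1 scale1r tensvZr linearZ /= M1.
- rewrite -[xop (xop _)]/(iter 2 xop _) iter_xop !xopE -HF tens_actF linearD /=.
  rewrite x1 (tops_F A_ops) /qint big_ord1 mulr1 tensvZr linearZ /= scaleNr.
  by rewrite expr1.
- by rewrite !xopE -HK tens_actK x1 (tops_K A_ops) !expr1 tensvZr linearZ.
Qed.

End XOperator.

Lemma xlinear_rmod (M L : rmoddata A) (f : 'Hom(M, L)) :
    rmodule N q M -> rmodule N q L ->
    (forall m, f (ract M (m \ox (x : A))) = ract L (f m \ox (x : A))) ->
  forall m (a : A), f (ract M (m \ox a)) = ract L (f m \ox a).
Proof.
move=> M_mod L_mod fx m a.
apply: (@tpoly_ext _ _ N_gt1 L (fun a => f (ract M (m \ox (a : A))))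
          (fun a => ract L (f m \ox (a : A)))) a.
- by move=> c u v; rewrite !linearP.
- by move=> c u v; rewrite !linearP.
move=> n _; rewrite -!iter_xop //; elim: n => //= n IH.
by rewrite !xopE fx IH.
Qed.

Lemma tens_ractE (P : uqdata (k := k)) (M : rmoddata A) (p : P) (m : M) (a : A) :
  ract (tens_rmod P M) ((p \ox m : uq_tens P M) \ox a) = p \ox ract M (m \ox a).
Proof.
pose R (b : A) : 'End(M) := linfun (fun m : M => ract M (m \ox b)).
have RE b m' : R b m' = ract M (m' \ox b).
  by rewrite /R linfunE // => c u v; rewrite tensvDl tensvZl linearP.
(* Recognising the inner lift as a [tens_map] gives access to its linearity in the algebra
   variable. *)
have inner (t : uq_tens P M) (b : A) :
    tens_lift (fun (p : P) (m : M) => p \ox ract M (m \ox b)) t = tens_map \1%VF (R b) t.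
  congr (fun_of_lfun _ t); apply: tens_ext => p' m'.
  rewrite tens_mapE id_lfunE RE tens_liftE // => [w|v] c u u'.
    by rewrite tensvDl tensvZl.
  by rewrite tensvDl tensvZl !linearP.
rewrite /= tens_liftE => [|b c t t'|t c b b']; last 2 first.
- by rewrite linearP.
- rewrite !inner -scale_lfunE -[RHS]add_lfunE; congr (fun_of_lfun _ t).
  apply: tens_ext => p' m'; rewrite add_lfunE scale_lfunE !tens_mapE !RE.
  by rewrite !linearP.
by rewrite inner tens_mapE id_lfunE RE.
Qed.

Lemma tens_rmodule (P : uqdata (k := k)) (M : rmoddata A) :
  uq_module N q P -> rmodule N q M -> rmodule N q (tens_rmod P M).
Proof.
move=> P_mod M_rmod; have M_mod := rmod_module M_rmod.
have PM_mod := uq_tens_module N_odd q_prim P_mod M_mod.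
have [HE HF HK] := ract_hom M_rmod.
have ext (U : vectType k) (f g : 'Hom(tens (tens P M) A, U)) :
    (forall (p : P) (m : M) (a : A), f ((p \ox m) \ox a) = g ((p \ox m) \ox a)) -> f = g.
  move=> fg; apply: tens_ext => t a.
  apply: (@eq_linear_tens _ P M U (fun t => f (t \ox a)) (fun t => g (t \ox a))) t => //.
  - by move=> c u v; rewrite tensvDl tensvZl linearP.
  - by move=> c u v; rewrite tensvDl tensvZl linearP.
split.
- exact: PM_mod.
- split=> u; rewrite -!comp_lfunE; congr (fun_of_lfun _ u); apply: ext => p m a;
    rewrite !comp_lfunE tens_ractE.
  + rewrite (@tens_actE _ (uq_tens P M) A) !tens_actE tensvDl !linearD /= !tens_ractE.
    by rewrite -HE -HK tens_actE tens_actK linearD /= tensvDr addrA.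
  + rewrite (@tens_actF _ (uq_tens P M) A) !tens_actF tensvDl !linearD /=.
    rewrite (tens_actKV N_odd P_mod M_mod) !tens_ractE.
    by rewrite -HF tens_actF linearD /= tensvDr addrA.
  + rewrite (@tens_actK _ (uq_tens P M) A) !tens_actK tens_ractE.
    by rewrite -HK tens_actK.
- move=> t a b.
  apply: (@eq_linear_tens _ P M _
    (fun t => ract (tens_rmod P M) (ract (tens_rmod P M) (t \ox a) \ox b))
    (fun t => ract (tens_rmod P M) (t \ox amul A (a \ox b)))) t => [||p m].
  + by move=> c u v; rewrite tensvDl tensvZl linearP tensvDl tensvZl linearP.
  + by move=> c u v; rewrite tensvDl tensvZl linearP.
  + by rewrite !tens_ractE (ractA M_rmod).
- move=> t.
  apply: (@eq_linear_tens _ P M _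
    (fun t => ract (tens_rmod P M) (t \ox aunit A 1)) id) t => [||p m] //.
  + by move=> c u v; rewrite tensvDl tensvZl linearP.
  + by rewrite tens_ractE (ract1 M_rmod).
Qed.

(** Since x generates A, A-linearity is commutation with the operators [xop], so [xaction_lift]
    provides the lift. *)
Lemma tpoly_exact : exact_alg N q A.
Proof.
move=> P M P_proj M_rmod; have [P_mod _] := P_proj.
have PM_rmod := tens_rmodule P_mod M_rmod.
split=> // X Y g f X_rmod Y_rmod [gH gA] gS [fH fA].
have gx m : g (@xop X m) = @xop Y (g m) by rewrite !xopE gA.
have fx p m : f (p \ox @xop M m) = @xop Y (f (p \ox m)).
  by rewrite !xopE -fA tens_ractE.
have [f' [f'H f'x gf']] := xaction_lift N_odd q_prim (rmod_module M_rmod) (rmod_module X_rmod)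
  (rmod_module Y_rmod) (xop_xaction M_rmod) (xop_xaction X_rmod) (xop_xaction Y_rmod)
  P_proj gH gS gx fH fx.
exists f' => //; split=> //; apply: xlinear_rmod => // t.
apply: (@eq_linear_tens _ P M _
  (fun t => f' (ract (tens_rmod P M) (t \ox (x : A))))
  (fun t => ract X (f' t \ox (x : A)))) t => [||p m].
- by move=> c u v; rewrite tensvDl tensvZl !linearP.
- by move=> c u v; rewrite linearP tensvDl tensvZl linearP.
- by rewrite tens_ractE -!xopE f'x.
Qed.

End Exactness.

(** * Character sums and quadratic Gauss sums *)

Section CharacterSums.
Context {k : fieldType} {N : nat}.

Lemma sum_unity_root (z : k) : z ^+ N = 1 -> z != 1 -> \sum_(s < N) z ^+ s = 0.
Proof.
move=> zN z1; apply: (mulfI (x := z - 1)); first by rewrite subr_eq0.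
by rewrite -subrX1 zN subrr mulr0.
Qed.

(** Orthogonality of characters: the sum over s vanishes unless t^r = z, which singles out r =
    r0. *)
Lemma fourier_inversion (t z y : k) (r0 : 'I_N) : N.-primitive_root t -> z = t ^+ r0 ->
  \sum_(s < N) \sum_(r < N) (z / t ^+ r) ^+ s * y ^+ r = N%:R * y ^+ r0.
Proof.
move=> tp ->; have t0 : t != 0.
  apply: contra_eq_neq (prim_expr_order tp) => ->.
  by rewrite expr0n gtn_eqF ?(leq_ltn_trans _ (ltn_ord r0)) // eq_sym oner_eq0.
rewrite exchange_big (bigD1 r0) //= -mulr_suml divff ?expf_neq0 //.
rewrite [X in X * _](eq_bigr (fun=> 1)) => [|i _]; last by rewrite expr1n.
rewrite sumr_const card_ord big1 ?addr0 // => r rr0.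
rewrite -mulr_suml sum_unity_root ?mul0r //.
  by rewrite exprMn exprVn !(exprAC t _ N) (prim_expr_order tp) !expr1n divr1.
rewrite -(inj_eq (mulIf (expf_neq0 r t0))) divfK ?expf_neq0 // mul1r.
rewrite (eq_prim_root_expr tp) !modn_small // -val_eqE /= in rr0 *.
by rewrite eq_sym.
Qed.

(** A shift by one trades the first term for the one N places later, equal to it by periodicity.
    Integer induction covers both signs of [c]. *)
Lemma sum_shift (f : int -> k) (c : int) : (forall j, f (j + N%:Z) = f j) ->
  \sum_(j < N) f (j%:Z + c) = \sum_(j < N) f j%:Z.
Proof.
move=> fN.
have step (d : int) : \sum_(j < N) f (j%:Z + (d + 1)) = \sum_(j < N) f (j%:Z + d).
  have := fN d; case: N => [|n] fd; first by rewrite !big_ord0.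
  rewrite big_ord_recr [RHS]big_ord_recl /= addrC; congr (_ + _).
    by rewrite [in RHS]add0r -fd; congr f; rewrite -[n.+1]addn1 PoszD; ring.
  by apply: eq_bigr => i _; congr f; rewrite /bump /= PoszD; ring.
elim/int_rect: c => [|n IH|n IH].
- by apply: eq_bigr => j _; rewrite addr0.
- by rewrite -[n.+1]addn1 PoszD step IH.
- rewrite -IH -step; apply: eq_bigr => j _; congr f.
  by rewrite -[n.+1]addn1 PoszD; ring.
Qed.

(** Completing the square: (j+1)^2 + 2cj = (j+c+1)^2 - c^2 - 2c. *)
Lemma gauss_sum_shift (s : k) (c : int) : s ^+ N = 1 -> s != 0 ->
  \sum_(j < N) s ^ ((j%:Z + 1) ^+ 2 + 2 * c * j%:Z)
  = (\sum_(j < N) s ^ ((j%:Z + 1) ^+ 2)) * s ^ (- c ^+ 2 - 2 * c).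
Proof.
move=> sN s0; pose f (j : int) := s ^ ((j + 1) ^+ 2).
have fN j : f (j + N%:Z) = f j.
  have -> : f (j + N%:Z) = f j * (s ^ N%:Z) ^ (2 * (j + 1) + N%:Z).
    by rewrite exprz_exp -expfzDr //; congr (_ ^ _); ring.
  by rewrite -exprnP sN exp1rz mulr1.
rewrite -(sum_shift c fN) mulr_suml; apply: eq_bigr => j _.
by rewrite -expfzDr //; congr (_ ^ _); ring.
Qed.

(** Were the sum 0, its variants with the linear term 2cj would all be 0. Summing these over c and
    exchanging the sums leaves, by orthogonality, only j = 0, which contributes N s. *)
Lemma gauss_sum_neq0 (s : k) : N.-primitive_root (s ^+ 2) -> s ^+ N = 1 -> N%:R != 0 :> k ->
  \sum_(j < N) s ^ ((j%:Z + 1) ^+ 2) != 0.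
Proof.
move=> s2p sN N0; have Np : (0 < N)%N := prim_order_gt0 s2p.
have s0 : s != 0.
  by apply: contra_eq_neq sN => ->; rewrite expr0n gtn_eqF // eq_sym oner_eq0.
apply: contraNneq N0 => G0.
have : \sum_(c < N) \sum_(j < N) s ^ ((j%:Z + 1) ^+ 2 + 2 * c%:Z * j%:Z) = 0.
  by rewrite big1 // => c _; rewrite gauss_sum_shift // G0 mul0r.
rewrite exchange_big (bigD1 (Ordinal Np)) //= [X in _ + X]big1 ?addr0 => [|j j0].
  rewrite (eq_bigr (fun=> s)) => [|c _]; last by rewrite [X in _ ^ (_ + X)]mulr0 addr0.
  by rewrite sumr_const card_ord => /eqP; rewrite -[s *+ N]mulr_natr mulf_eq0 (negPf s0).
transitivity (\sum_(c < N) s ^ ((j%:Z + 1) ^+ 2) * ((s ^+ 2) ^+ j) ^+ c).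
  apply: eq_bigr => c _; rewrite expfzDr // -!exprM; congr (_ * _).
  by rewrite exprnP; congr (_ ^ _); rewrite !PoszM; ring.
rewrite -mulr_sumr sum_unity_root ?mulr0 //.
  by rewrite exprAC (prim_expr_order s2p) expr1n.
by apply: (prim_expr_neq1 s2p); rewrite ltn_ord andbT lt0n; exact: j0.
Qed.

End CharacterSums.

(** * The braiding on weight vectors *)

Section Braiding.
Context {k : fieldType} {N : nat} {q : k}.
Hypotheses (N_odd : odd N) (q_prim : N.-primitive_root q) (N_neq0 : N%:R != 0 :> k).
Let q0 : q != 0 := q_neq0 N_odd q_prim.

Lemma braidE (V W : uqdata (k := k)) (v : V) (w : W) :
  braid N q V W (v \ox w) = N%:R^-1 *:
    \sum_(p < N) \sum_(s < N) \sum_(r < N)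
      ((q - q^-1) ^+ p / qfact q p
       * q ^ ((p * p.-1)./2%:Z + 2 * p%:Z * (s%:Z - r%:Z) - 2 * s%:Z * r%:Z))
      *: (iter p (actF W) (iter r (actK W) w)
          \ox iter p (actE V) (iter s (actK V) v)).
Proof.
rewrite /braid tens_liftE // => [w'|v'] c u u'; rewrite scalerA mulrC -scalerA -scalerDr;
  congr (_ *: _); rewrite scaler_sumr -big_split; apply: eq_bigr => p _ /=;
  rewrite scaler_sumr -big_split; apply: eq_bigr => s _ /=;
  rewrite scaler_sumr -big_split; apply: eq_bigr => r _ /=.
  by rewrite !linearP /= scalerA mulrC -scalerA.
by rewrite !linearP /= tensvDl tensvZl scalerDr !scalerA mulrC.
Qed.

(** For K-weights t^(-a) and t^(-b) and fixed p, the double sum is a Fourier inversion at z =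
    t^(p-a). *)
Lemma R_matrix_weight (a b p : nat) :
  N%:R^-1 * (\sum_(s < N) \sum_(r < N)
    q ^ ((p * p.-1)./2%:Z + 2 * p%:Z * (s%:Z - r%:Z) - 2 * s%:Z * r%:Z)
    * (((q ^+ 2) ^- a) ^+ s * ((q ^+ 2) ^- b) ^+ r))
  = q ^+ (p * p.-1)./2 * ((q ^+ 2) ^+ p / (q ^+ 2) ^+ a) ^- (p + b).
Proof.
set t := q ^+ 2; have tp : N.-primitive_root t := q2_prim N_odd q_prim.
pose z := t ^+ p / t ^+ a; pose y := (t ^+ (p + b))^-1.
have zN : z ^+ N = 1.
  by rewrite exprMn exprVn !(exprAC t _ N) (prim_expr_order tp) !expr1n divr1.
(* The discrete logarithm of [z]; p - a may be negative, so it cannot serve directly as an index. *)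
have [r0 zr0] := prim_rootP tp zN.
transitivity (N%:R^-1 * \sum_(s < N) \sum_(r < N)
    q ^+ (p * p.-1)./2 * ((z / t ^+ r) ^+ s * y ^+ r)).
  congr (_ * _); apply: eq_bigr => s _; apply: eq_bigr => r _.
  have -> : q ^ ((p * p.-1)./2%:Z + 2 * p%:Z * (s%:Z - r%:Z) - 2 * s%:Z * r%:Z)
     = q ^+ (p * p.-1)./2 * (t ^+ p / t ^+ r) ^+ s * (t ^- p) ^+ r.
    have tE (n : nat) : t ^+ n = q ^ (2 * n%:Z) by rewrite -exprM exprnP PoszM.
    rewrite !tE exprnP !invr_expz -!expfzDr // !exprnP !exprz_exp -!expfzDr //.
    by congr (_ ^ _); ring.
  by rewrite /y /z exprD invfM !exprMn !exprVn; ring.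
under eq_bigr => s _ do rewrite -mulr_sumr.
rewrite -mulr_sumr (fourier_inversion y tp zr0) mulrCA mulKf //.
by rewrite /y exprVn exprAC -zr0.
Qed.

Lemma iter_actK_weight (V : uqdata (k := k)) (v : V) c n :
  actK V v = c *: v -> iter n (actK V) v = c ^+ n *: v.
Proof.
move=> Kv; elim: n => [|n IH] /=; first by rewrite scale1r.
by rewrite IH linearZ /= Kv scalerA exprSr.
Qed.

Lemma braid_weight (V W : uqdata (k := k)) (v : V) (w : W) (a b : nat) :
    actK V v = (q ^+ 2) ^- a *: v -> actK W w = (q ^+ 2) ^- b *: w ->
  braid N q V W (v \ox w) = \sum_(p < N)
    ((q - q^-1) ^+ p / qfact q p * (q ^+ (p * p.-1)./2
     * ((q ^+ 2) ^+ p / (q ^+ 2) ^+ a) ^- (p + b)))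
    *: (iter p (actF W) w \ox iter p (actE V) v).
Proof.
move=> Kv Kw; rewrite braidE scaler_sumr; apply: eq_bigr => p _.
rewrite -R_matrix_weight mulrCA -scalerA mulr_sumr scaler_suml; congr (_ *: _).
apply: eq_bigr => s _; rewrite mulr_sumr scaler_suml; apply: eq_bigr => r _.
rewrite (iter_actK_weight _ Kv) (iter_actK_weight _ Kw) !linearZ /= tensvZl !scalerA.
by congr (_ *: _); ring.
Qed.

(** A map [L] that kills all terms with p > 0 sees only the Cartan part of the R-matrix. The weights
    t^(-a) and t^(-b) are those observed through [L]; [v] and [w] may be arbitrary vectors. *)
Lemma braid_functional (V W : uqdata (k := k)) (U : vectType k) (L : 'Hom(tens W V, U))
    (v : V) (w : W) (a b : nat) (c : U) :
    (forall p r s, (0 < p)%N -> L (iter p (actF W) (iter r (actK W) w)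
       \ox iter p (actE V) (iter s (actK V) v)) = 0) ->
    (forall r s, L (iter r (actK W) w \ox iter s (actK V) v)
       = (((q ^+ 2) ^- a) ^+ s * ((q ^+ 2) ^- b) ^+ r) *: c) ->
  L (braid N q V W (v \ox w)) = (q ^+ 2) ^+ (a * b) *: c.
Proof.
move=> L_pos L0; rewrite braidE linearZ linear_sum /=.
rewrite (bigD1 (Ordinal (odd_gt0 N_odd))) //= [X in _ + X]big1 ?addr0 => [|p p0]; last first.
  rewrite linear_sum big1 // => s _; rewrite linear_sum big1 // => r _.
  by rewrite linearZ /= L_pos ?scaler0 // lt0n; apply: p0.
have := R_matrix_weight a b 0; rewrite !expr0 !mul1r add0n exprVn invrK -(exprM (q ^+ 2)) => <-.
rewrite -scalerA scaler_suml linear_sum; congr (_ *: _).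
apply: eq_bigr => s _; rewrite scaler_suml linear_sum; apply: eq_bigr => r _.
by rewrite linearZ /= L0 scalerA /qfact big_geq // invr1 mul1r.
Qed.

End Braiding.

(** * Commutativity and triviality of the twist *)

Section CommutativityTwist.
Context {k : fieldType} {N : nat} {q : k}.
Hypotheses (N_odd : odd N) (N_gt1 : (1 < N)%N) (q_prim : N.-primitive_root q).
Hypothesis N_neq0 : N%:R != 0 :> k.

Local Notation T := {poly %/ ('X^N : {poly k})}.
Local Notation x := ('qX : T).
Local Notation t := (q ^+ 2).
Let q0 : q != 0 := q_neq0 N_odd q_prim.
Let t_prim : N.-primitive_root t := q2_prim N_odd q_prim.
Let t0 : t != 0. Proof. by rewrite expf_neq0. Qed.

Variable act : uqops (@tpoly k N).
Hypothesis act_x : tpoly_action q act.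
Local Notation A := (tpoly_alg act).

Let A_ops : tpoly_basis_ops (q := q) act. Proof. exact: tpoly_actionE. Qed.

Lemma qfactS p : qfact q p.+1 = qfact q p * ((q ^+ p.+1 - q ^- p.+1) / (q - q^-1)).
Proof. by rewrite /qfact big_nat_recr. Qed.

Lemma qfact0 : qfact q 0 = 1.
Proof. by rewrite /qfact big_geq. Qed.

Lemma triangleS p : (p.+1 * p)./2 = ((p * p.-1)./2 + p)%N.
Proof. by rewrite -[p in (_ * p)%N]/(p.+1.-1) -!bin2 binS bin1. Qed.

Lemma prim_sub_neq0 (s : k) p : N.-primitive_root s -> (p.+1 < N)%N -> s ^+ p.+1 - 1 != 0.
Proof. by move=> sp pN; rewrite subr_eq0 (prim_expr_neq1 sp). Qed.

(** Identifies the p-th coefficient of the braided product of x^a and x^b with t^(ab) times the p-th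
    Newton term at w = t^(-b). Induction on p compares ratios of consecutive terms. *)
Lemma comm_coef a b p : (a < N)%N -> (p <= a)%N ->
  (q - q^-1) ^+ p / qfact q p * q ^+ (p * p.-1)./2 * (t ^+ p / t ^+ a) ^- (p + b)
  * ((\prod_(i < p) (- q * qint (Q := t) (b + i))) * \prod_(i < p) qint (Q := q ^- 2) (a - i))
  = t ^+ (a * b) * (qbin t a p * \prod_(i < p) (t ^- b - t ^+ i)).
Proof.
move=> aN; elim: p => [|p IH] pa.
  rewrite qfact0 qbin0 !big_ord0 !mulr1 invr1 !mul1r add0n.
  by rewrite exprVn invrK exprM.
have pa' : (p <= a)%N := ltnW pa; move: (IH pa') => {}IH.
pose ratio := (t ^+ a / t ^+ p - 1) / (t ^+ p.+1 - 1) * (t ^- b - t ^+ p).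
rewrite qbinSr !big_ord_recr /= [in RHS](mulrACA (qbin t a p)) -/ratio [RHS]mulrA -IH {IH}.
rewrite triangleS qfactS.
have -> : (t ^+ p.+1 / t ^+ a) ^- (p.+1 + b) =
    (t ^+ p / t ^+ a) ^- (p + b) * ((t ^+ (p + b))^-1 * (t ^+ a / t ^+ p.+1)).
  rewrite -[t ^+ a / _]invf_div [t ^+ p.+1]exprS -mulrA; move: (t ^+ p / _) => z.
  by rewrite addSn [_ ^+ _.+1]exprSr exprMn !invfM; ring.
rewrite [q ^+ (_ + p)]exprD [(q - q^-1) ^+ p.+1]exprS [(qfact _ _ * _)^-1]invfM.
suff -> : ratio = (q - q^-1) / ((q ^+ p.+1 - q ^- p.+1) / (q - q^-1)) * q ^+ p
    * ((t ^+ (p + b))^-1 * (t ^+ a / t ^+ p.+1))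
    * ((- q * qint (Q := t) (b + p)) * qint (Q := q ^- 2) (a - p)) by ring.
rewrite /ratio (qint_q2 N_odd N_gt1 q_prim) (qint_q2V N_odd N_gt1 q_prim) (expfB _ pa).
rewrite !exprD ![t ^+ _]exprAC !exprS.
have qp : q * q ^+ p * (q * q ^+ p) - 1 != 0.
  by rewrite -exprS -expr2 exprAC prim_sub_neq0 // (leq_ltn_trans pa).
have q21 : q * q - 1 != 0 by rewrite -expr2 (q2_sub1_neq0 N_odd N_gt1 q_prim).
have := expf_neq0 b q0; have := expf_neq0 a q0; have := expf_neq0 p q0.
move: (q ^+ a) (q ^+ b) (q ^+ p) qp => u v w qp w0 u0 v0.
by field; rewrite q0 u0 v0 w0 q21 qp.
Qed.

Lemma prod_qint_small a p : (a < p)%N -> \prod_(i < p) qint (Q := q ^- 2) (a - i) = 0.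
Proof.
by move=> ap; rewrite (bigD1 (Ordinal ap)) //= subnn [qint 0]big_ord0 mul0r.
Qed.

Lemma tpoly_commutative : commutative_alg N q A.
Proof.
apply: (tpoly_tens_ext N_gt1) => a b aN bN; rewrite comp_lfunE.
have KX n : actK A (x ^+ n) = t ^- n *: x ^+ n by rewrite (tops_K A_ops) exprVn.
rewrite (@braid_weight _ _ _ N_odd q_prim N_neq0 A A _ _ a b) ?KX // linear_sum /=.
transitivity ((\sum_(p < N) t ^+ (a * b) * (qbin t a p * \prod_(i < p) (t ^- b - t ^+ i)))
    *: (x ^+ (a + b) : tpoly N)); last first.
  (* The prefactor t^(ab) cancels w^a = t^(-ab). *)
  rewrite -mulr_sumr newton_qbin //; last exact: prim_expr_neq1.
  rewrite exprVn [(a * b)%N]mulnC [t ^+ (b * a)]exprM divff ?expf_neq0 // scale1r.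
  by rewrite (tpoly_mulE act) -exprD.
rewrite scaler_suml; apply: eq_bigr => p _.
rewrite (iter_tops_E A_ops) (iter_tops_F A_ops) !(tensvZl, tensvZr) !linearZ /=.
rewrite (tpoly_mulE act) -exprD !scalerA.
(* For p > a both E^p x^a and the Gaussian binomial vanish. *)
have [pa|ap] := leqP p a; last first.
  by rewrite prod_qint_small // qbin_small // !(mul0r, mulr0) !scale0r.
have -> : (b + p + (a - p) = a + b)%N by rewrite -addnA subnKC // addnC.
by rewrite -comm_coef //; congr (_ *: _); ring.
Qed.

Let s := qsqrt N q.
Let s2 : s ^+ 2 = q.
Proof.
rewrite /s /qsqrt -exprM muln2 -[RHS]mul1r -(prim_expr_order q_prim) -exprSr.
by rewrite halfK /= N_odd subn0.
Qed.
Let sN : s ^+ N = 1.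
Proof. by rewrite /s /qsqrt exprAC (prim_expr_order q_prim) expr1n. Qed.
Let s0 : s != 0. Proof. by rewrite expf_neq0. Qed.

(** The same comparison of ratios for the twist, at w = t^(a-1), written [t ^+ a / t] because [a.-1]
    is truncated at a = 0. The power of [s] is what completing the square leaves, with c = m -
    2a. *)
Lemma twist_coef a m : (a < N)%N -> (m <= a)%N ->
  (q - q^-1) ^+ m / qfact q m * (-1) ^+ m
  * s ^ (- m%:Z - (m%:Z - 2 * a%:Z) ^+ 2 - 2 * (m%:Z - 2 * a%:Z))
  * ((\prod_(i < m) qint (Q := q ^- 2) (a - i))
     * \prod_(i < m) (- q * qint (Q := t) (a.-1 - i)))
  = (t ^+ a / t) ^- a * (qbin t a m * \prod_(i < m) (t ^+ a / t - t ^+ i)).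
Proof.
have tE : t = s ^ 4 by rewrite -s2 -exprM.
have tX n : t ^+ n = s ^ (4 * n%:Z) by rewrite tE exprnP exprz_exp.
have sV (n : int) : s ^ (- n) = (s ^ n)^-1 by rewrite invr_expz.
move=> aN; elim: m => [|m IH] ma.
  have -> : t ^+ a / t = s ^ (4 * a%:Z - 4) by rewrite expfzDr // sV -tX -tE.
  rewrite qfact0 qbin0 !big_ord0 !mulr1 invr1 !mul1r [_ ^+ a]exprnP exprz_exp -sV.
  by congr (_ ^ _); ring.
have := IH (ltnW ma) => {}IH.
pose ratio := (t ^+ a / t ^+ m - 1) / (t ^+ m.+1 - 1) * (t ^+ a / t - t ^+ m).
rewrite qbinSr !big_ord_recr /= [in RHS](mulrACA (qbin t a m)) -/ratio [RHS]mulrA -IH {IH}.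
rewrite qfactS ![_ ^+ m.+1]exprS [(qfact _ _ * _)^-1]invfM.
have -> : s ^ (- m.+1%:Z - (m.+1%:Z - 2 * a%:Z) ^+ 2 - 2 * (m.+1%:Z - 2 * a%:Z))
    = s ^ (- m%:Z - (m%:Z - 2 * a%:Z) ^+ 2 - 2 * (m%:Z - 2 * a%:Z)) * (t ^+ a / (q ^+ m * t)).
  have -> : t ^+ a / (q ^+ m * t) = s ^ (4 * a%:Z - (2 * m%:Z + 4)).
    rewrite expfzDr // sV expfzDr // -tX -tE; congr (_ / (_ * _)).
    by rewrite -exprz_exp -[s ^ 2]/(s ^+ 2) s2.
  by rewrite -expfzDr //; congr (_ ^ _); rewrite -[m.+1]addn1 PoszD; ring.
suff -> : ratio = (q - q^-1) / ((q * q ^+ m - (q * q ^+ m)^-1) / (q - q^-1)) * (-1)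
    * (t ^+ a / (q ^+ m * t))
    * (qint (Q := q ^- 2) (a - m) * (- q * qint (Q := t) (a.-1 - m))) by ring.
have -> : (a.-1 - m = a - m.+1)%N by rewrite -subn1 -subnDA add1n.
have qB n : (n <= a)%N -> q ^+ (a - n) = q ^+ a / q ^+ n.
  by move=> na; rewrite expfB_cond // (negPf q0).
rewrite /ratio (qint_q2 N_odd N_gt1 q_prim) (qint_q2V N_odd N_gt1 q_prim) (qB _ ma).
rewrite (qB _ (ltnW ma)).
rewrite ![t ^+ _]exprAC !exprS.
have qm : q * q ^+ m * (q * q ^+ m) - 1 != 0.
  by rewrite -exprS -expr2 exprAC prim_sub_neq0 // (leq_ltn_trans ma).
have q21 : q * q - 1 != 0 by rewrite -expr2 (q2_sub1_neq0 N_odd N_gt1 q_prim).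
have := expf_neq0 a q0; have := expf_neq0 m q0.
move: (q ^+ a) (q ^+ m) qm => u w qm w0 u0.
by field; rewrite q0 u0 w0 q21 qm.
Qed.

(** F^m climbs from x^(a-m) and lists the q-integers upwards; the descending order suits induction
    on m. *)
Lemma prod_qint_rev a m : (m <= a)%N -> \prod_(i < m) (- q * qint (Q := t) (a - m + i))
  = \prod_(i < m) (- q * qint (Q := t) (a.-1 - i)).
Proof.
move=> ma; rewrite (reindex_inj rev_ord_inj); apply: eq_bigr => i _ /=.
congr (_ * qint _); rewrite addnBA // subnK // -subn1 -subnDA add1n //.
Qed.

Definition gauss_sum : k := \sum_(j < N) s ^ ((j%:Z + 1) ^+ 2).

(** E and F act by 0 on the unit object, so only m = 0 contributes: the twist is normalised by a
    Gauss sum. *)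
Lemma ribbon_sum_unit : ribbon_sum N q (V := uq_unit) 1 = gauss_sum :> k.
Proof.
rewrite /ribbon_sum (bigD1 (Ordinal (ltnW N_gt1))) //= [X in _ + X]big1 ?addr0 => [|m m0].
  apply: eq_bigr => j _; rewrite expr0 qfact0 divr1 !mul1r oppr0 mulr0 mul0r !add0r.
  have -> : iter j (actK uq_unit) 1 = 1 :> k^o.
    by elim: (nat_of_ord j) => //= n ->; rewrite /actK /= id_lfunE.
  exact: mulr1.
rewrite big1 // => j _; case: m m0 => -[//|m] mN _ /=.
by rewrite /actF /= zero_lfunE scaler0.
Qed.

Lemma tpoly_twist : twist N q A = \1%VF.
Proof.
have G0 : gauss_sum != 0 by apply: gauss_sum_neq0 => //; rewrite s2.
have rL : linear (@ribbon_sum k N q A).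
  move=> c u v; rewrite /ribbon_sum scaler_sumr -big_split; apply: eq_bigr => m _ /=.
  rewrite scaler_sumr -big_split; apply: eq_bigr => j _ /=.
  by rewrite !linearP /= !scalerA mulrC.
apply/lfunP; apply: (tpoly_ext N_gt1) => [||a aN]; try exact: linearP.
rewrite id_lfunE /twist ribbon_sum_unit linfunE => [|c u v]; last first.
  by rewrite rL scalerDr !scalerA mulrC.
suff -> : ribbon_sum N q (V := A) (x ^+ a) = gauss_sum *: x ^+ a.
  by rewrite scalerA mulVf // scale1r.
(* The Newton sum equals w^a at w = t^(a-1), and the factor w^(-a) leaves the Gauss sum alone. *)
transitivity ((\sum_(m < N) gauss_sum * ((t ^+ a / t) ^- a
    * (qbin t a m * \prod_(i < m) (t ^+ a / t - t ^+ i)))) *: (x ^+ a : tpoly N)); last first.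
  rewrite -!mulr_sumr newton_qbin //; last exact: prim_expr_neq1.
  by rewrite mulVf ?mulr1 // expf_neq0 // mulf_neq0 ?invr_eq0 ?expf_neq0.
rewrite scaler_suml /ribbon_sum; apply: eq_bigr => m _.
have [ma|am] := leqP m a; last first.
  rewrite qbin_small // !(mul0r, mulr0) scale0r big1 // => j _.
  rewrite (iter_tops_K A_ops) !linearZ /= (iter_tops_E A_ops) prod_qint_small //.
  by rewrite scale0r !linear0 ?scaler0.
rewrite -twist_coef //.
(* K^j acts on x^a by s^(-4aj); together with the 2mj of the ribbon element, the extra linear
   exponent is 2cj. *)
pose c := m%:Z - 2 * a%:Z.
pose D := (q - q^-1) ^+ m / qfact q m * (-1) ^+ m * s ^ (- m%:Z)
  * ((\prod_(i < m) qint (Q := q ^- 2) (a - i))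
     * \prod_(i < m) (- q * qint (Q := t) (a.-1 - i))).
transitivity ((\sum_(j < N) D * s ^ ((j%:Z + 1) ^+ 2 + 2 * c * j%:Z)) *: (x ^+ a : tpoly N)).
  rewrite scaler_suml; apply: eq_bigr => j _.
  rewrite (iter_tops_K A_ops) !linearZ /= (iter_tops_E A_ops) !linearZ /= (iter_tops_F A_ops).
  rewrite subnK // !scalerA; congr (_ *: _).
  rewrite prod_qint_rev // /D -/s.
  have key : s ^ (- m%:Z + 2 * m%:Z * j%:Z + (j%:Z + 1) ^+ 2) * ((q ^- 2) ^+ a) ^+ j
      = s ^ (- m%:Z) * s ^ ((j%:Z + 1) ^+ 2 + 2 * c * j%:Z).
    have -> : ((q ^- 2) ^+ a) ^+ j = s ^ (- (4 * a%:Z * j%:Z)).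
      rewrite -invr_expz !exprVn -!exprM -[in LHS]s2 -exprM exprnP !PoszM.
      by congr (_ ^ _)^-1; ring.
    by rewrite -!expfzDr //; congr (_ ^ _); rewrite /c; ring.
  transitivity ((q - q^-1) ^+ m / qfact q m * (-1) ^+ m
    * (s ^ (- m%:Z + 2 * m%:Z * j%:Z + (j%:Z + 1) ^+ 2) * ((q ^- 2) ^+ a) ^+ j)
    * ((\prod_(i < m) qint (Q := q ^- 2) (a - i))
       * \prod_(i < m) (- q * qint (Q := t) (a.-1 - i)))); first by ring.
  by rewrite key; ring.
rewrite -mulr_sumr gauss_sum_shift // -/gauss_sum; congr (_ *: _).
by rewrite -/c /D !expfzDr //; ring.
Qed.

End CommutativityTwist.

(** * The tensor product over A and the dual module *)

Lemma tensA_rel_vanish (k : fieldType) (N : nat) (q : k) (A : algdata) (M L : rmoddata A)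
    (U : vectType k) (f : 'Hom(tens M L, U)) :
    (forall m a l, f (ract M (m \ox a) \ox l) = f (m \ox lact N q L (a \ox l))) ->
  forall u, u \in tensA_rel N q M L -> f u = 0.
Proof.
move=> fA u /memv_imgP[w _ ->].
pose rel (l : L) : 'Hom(tens M A, tens M L) := tens_lift (fun (m : M) (a : A) =>
  ract M (m \ox a) \ox l - m \ox lact N q L (a \ox l)).
have relE l m a : rel l (m \ox a) = ract M (m \ox a) \ox l - m \ox lact N q L (a \ox l).
  rewrite /rel tens_liftE // => [a'|m'] c v v'.
    rewrite !(tensvDl, tensvZl) linearD linearZ /= !(tensvDl, tensvZl).
    by apply: coord_ext => i; rewrite !(linearB, linearD, linearN, linearZ) /=; ring.
  rewrite !(tensvDr, tensvZr) !(tensvDl, tensvZl) !linearD !linearZ /=.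
  rewrite !(tensvDr, tensvZr, tensvDl, tensvZl).
  by apply: coord_ext => i; rewrite !(linearB, linearD, linearN, linearZ) /=; ring.
(* The relations are the image of a linear map, so vanishing is tested on (m (x) a) (x) l, where it
   is [fA]. *)
rewrite -comp_lfunE -[RHS](zero_lfunE U w); congr (fun_of_lfun _ w).
apply: tens_ext => t l; rewrite comp_lfunE zero_lfunE tens_liftE => [|l' c t1 t2|t' c l1 l2].
- rewrite -/(rel l) -comp_lfunE -[RHS](zero_lfunE U t); congr (fun_of_lfun _ t).
  by apply: tens_ext => m a; rewrite comp_lfunE relE linearB /= fA subrr zero_lfunE.
- by rewrite linearP.
- rewrite -!/(rel _) -scale_lfunE -[RHS]add_lfunE; congr (fun_of_lfun _ t').
  apply: tens_ext => m a; rewrite add_lfunE scale_lfunE !relE !(tensvDr, tensvZr).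
  rewrite linearD linearZ /= !(tensvDr, tensvZr).
  by apply: coord_ext => i; rewrite !(linearB, linearD, linearN, linearZ) /=; ring.
Qed.

Section Dual.
Context {k : fieldType} {N : nat} {q : k}.
Hypotheses (N_odd : odd N) (N_gt1 : (1 < N)%N) (q_prim : N.-primitive_root q).
Hypothesis N_neq0 : N%:R != 0 :> k.

Local Notation T := {poly %/ ('X^N : {poly k})}.
Local Notation x := ('qX : T).
Local Notation t := (q ^+ 2).
Let q0 : q != 0 := q_neq0 N_odd q_prim.
Let t_prim : N.-primitive_root t := q2_prim N_odd q_prim.
Let t0 : t != 0. Proof. by rewrite expf_neq0. Qed.

Variable act : uqops (@tpoly k N).
Hypothesis act_x : tpoly_action q act.
Local Notation A := (tpoly_alg act).
Local Notation D := (dual_rmod A).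

Let A_ops : tpoly_basis_ops (q := q) act. Proof. exact: tpoly_actionE. Qed.

(** The vector x^(N-1) spans the annihilator of x in A, so evaluation there turns the action of A on
    the dual into multiplication by constant terms. *)
Definition dual_top (f : D) : k^o := (f : 'Hom(A, k^o)) (x ^+ N.-1).

Lemma dual_top_linear : linear dual_top.
Proof. by move=> c f g; rewrite /dual_top add_lfunE scale_lfunE. Qed.

HB.instance Definition _ := GRing.isLinear.Build k D k^o _ dual_top dual_top_linear.

Lemma dual_top_F f : dual_top (actF D f) = 0.
Proof.
rewrite /dual_top /actF /= linfunE => [|c g1 g2]; last first.
  by rewrite comp_lfunDl -comp_lfunZl opprD scalerN.
rewrite opp_lfunE !comp_lfunE (tops_F A_ops) prednK ?(ltnW N_gt1) //.
by rewrite (tpolyX_nil N_gt1) // !linear0 ?oppr0.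
Qed.

Lemma dual_top_iter_F p f : (0 < p)%N -> dual_top (iter p (actF D) f) = 0.
Proof. by case: p => // p _ /=; rewrite dual_top_F. Qed.

Lemma dual_top_K f : dual_top (actK D f) = t^-1 *: dual_top f.
Proof.
rewrite /dual_top /actK /= linfunE => [|c g1 g2]; last first.
  by rewrite comp_lfunDl -comp_lfunZl.
rewrite comp_lfunE (tops_KV N_odd N_gt1 q_prim A_ops) linearZ /=; congr (_ *: _).
apply: (mulIf t0); rewrite mulVf // -exprSr prednK ?(ltnW N_gt1) //.
exact: prim_expr_order t_prim.
Qed.

Lemma dual_top_iter_K n f : dual_top (iter n (actK D) f) = t^-1 ^+ n *: dual_top f.
Proof.
elim: n => [|n IH] /=; first by rewrite scale1r.
by rewrite dual_top_K IH scalerA -exprS.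
Qed.

Lemma tpoly_mul_top (a : T) : a * x ^+ N.-1 = tcoef 0 a *: x ^+ N.-1.
Proof.
rewrite {1}[a](tpoly_expand N_gt1) mulr_suml (bigD1 (Ordinal (ltnW N_gt1))) //=.
rewrite -scalerAl mul1r big1 ?addr0 // => i i0.
rewrite -scalerAl -exprD (tpolyX_nil N_gt1) ?scaler0 //.
by rewrite -[X in (X <= _)%N](prednK (ltnW N_gt1)) -add1n leq_add2r lt0n; apply: i0.
Qed.

Lemma dual_top_ract f (a : A) : dual_top (ract D (f \ox a)) = tcoef 0 a *: dual_top f.
Proof. by rewrite /dual_top dual_ractE tpoly_mulE tpoly_mul_top linearZ. Qed.

Lemma tcoef0_iter_K n (a : T) : tcoef 0 (iter n (actK A) a) = tcoef 0 a.
Proof.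
elim: n => //= n IH.
by rewrite (tcoef_K N_odd N_gt1 q_prim act_x) expr0 scale1r.
Qed.

Lemma dual_top_lact (a : A) f : dual_top (lact N q D (a \ox f)) = tcoef 0 a *: dual_top f.
Proof.
pose L : 'Hom(uq_tens D A, k^o) := linfun (dual_top \o ract D).
have LE u : L u = dual_top (ract D u) by rewrite lfunE.
rewrite /lact comp_lfunE -LE.
(* The constant term on A has weight exponent 0 and [dual_top] has weight exponent 1, so the
   braiding contributes t^0. *)
rewrite (braid_functional N_odd q_prim N_neq0 (a := 0) (b := 1) (c := tcoef 0 a *: dual_top f)).
- by rewrite mul0n scale1r.
- by move=> p r s p0; rewrite LE dual_top_ract dual_top_iter_F ?scaler0.
- move=> r s; rewrite LE dual_top_ract tcoef0_iter_K dual_top_iter_K !scalerA.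
  by congr (_ *: _); rewrite expr0 invr1 expr1n mul1r expr1 mulrC.
Qed.

Definition dual_top2 : 'Hom(tens D D, k^o) :=
  tens_lift (fun f g : D => dual_top f * dual_top g : k^o).

Lemma dual_top2E (f g : D) : dual_top2 (f \ox g) = dual_top f * dual_top g.
Proof.
rewrite /dual_top2 tens_liftE // => [h|h] c u v; rewrite linearP.
  by rewrite mulrDl -[_ *: _]/(_ * _) -mulrA.
by rewrite mulrDr -[_ *: _]/(_ * _) mulrCA.
Qed.

(** Both factors show weight t^(-1) and [dual_top] kills the image of F, so the Cartan part alone
    contributes. *)
Lemma dual_top2_braid u : dual_top2 (braid N q D D u) = t *: dual_top2 u.
Proof.
rewrite -comp_lfunE -scale_lfunE; congr (fun_of_lfun _ u); apply: tens_ext => f g.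
rewrite comp_lfunE scale_lfunE.
rewrite (@braid_functional _ _ _ N_odd q_prim N_neq0 D D _ _ _ _ 1 1 (dual_top2 (f \ox g))) //.
  by move=> p r s p0; rewrite dual_top2E dual_top_iter_F ?mul0r.
move=> r s; rewrite !dual_top2E !dual_top_iter_K expr1 -![_ *: _]/(_ * _).
by ring.
Qed.

Lemma dual_top2_rel u : u \in tensA_rel N q D D -> dual_top2 u = 0.
Proof.
apply: tensA_rel_vanish => f a g; rewrite !dual_top2E dual_top_ract dual_top_lact.
by rewrite -![_ *: _]/(_ * _); ring.
Qed.

(** Membership in the centre includes locality, so the dual may be tested against itself. Seen
    through [dual_top2], which descends to the tensor product over A, the double braiding is
    multiplication by t^2 = q^4. *)
Lemma dual_not_muger : ~ in_muger_center N q D.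
Proof.
move=> [D_loc /(_ D D_loc) cc].
have projE u : dual_top2 (vsval (vquot_proj (tensA_rel N q D D) u)) = dual_top2 u.
  by rewrite vquot_projE linearB /= (dual_top2_rel (memv_proj _ _)) subr0.
have braidAE v : dual_top2 (vsval (braidA N q D D v)) = t *: dual_top2 (vsval v).
  by rewrite /braidA /vquot_map !comp_lfunE projE lfunE dual_top2_braid.
(* The functional dual to x^(N-1) gives a vector on which [dual_top2] is nonzero. *)
pose y : D := linfun (fun a : A => tcoef N.-1 a).
have y1 : dual_top y = 1.
  by rewrite /dual_top /y linfunE ?(tcoefX N_gt1) ?eqxx ?prednK ?(ltnW N_gt1) //; exact: linearP.
pose v := vquot_proj (tensA_rel N q D D) (y \ox y).
have v1 : dual_top2 (vsval v) = 1 by rewrite projE dual_top2E y1 mulr1.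
have /lfunP/(_ v) := cc; rewrite comp_lfunE id_lfunE.
move/(congr1 (fun v => dual_top2 (vsval v))); rewrite !braidAE v1 scalerA.
rewrite -expr2 -[_ *: _]/(_ * _) mulr1; apply/eqP.
(* Being odd, N exceeds 2, which makes t^2 differ from 1. *)
have N_gt2 : (2 < N)%N by rewrite ltn_neqAle N_gt1 andbT; apply: contraTneq N_odd => <-.
exact: (prim_expr_neq1 t_prim).
Qed.

End Dual.

(** * The complex root of unity *)

Section RootOfUnity.
Context {R : realType}.

Lemma cexpiD (a b : R) : cexpi (a + b) = cexpi a * cexpi b.
Proof.
by apply/eqP; rewrite eq_complex /= cosD sinD eqxx /= addrC.
Qed.

Lemma cexpi_exp (a : R) n : cexpi a ^+ n = cexpi (a *+ n).
Proof.
elim: n => [|n IH]; first by rewrite /cexpi cos0 sin0.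
by rewrite exprS IH mulrS cexpiD.
Qed.

(** For 0 < i < n the half angle u = pi i / n lies strictly between 0 and pi, so sin u > 0 and cos
    2u < 1. *)
Lemma cexpi_prim (n : nat) : (0 < n)%N -> n.-primitive_root (cexpi (2 * pi / n%:R) : R[i]).
Proof.
move=> n0; have nR : 0 < n%:R :> R by rewrite ltr0n.
apply/andP; split=> //; apply/forallP => i; rewrite unity_rootE cexpi_exp; apply/eqP.
set u := pi / n%:R *+ i.+1 : R.
have -> : 2 * pi / n%:R *+ i.+1 = u *+ 2 :> R.
  by rewrite /u -mulrA -mulrnAr mulr_natl.
have [iN|iN] := eqVneq i.+1 n.
  have -> : u = pi by rewrite /u iN -mulr_natr divfK ?gt_eqF.
  by rewrite /cexpi mulr2n cosDpi sinDpi cospi sinpi opprK oppr0 eqxx.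
have u_gt0 : 0 < u by rewrite /u pmulrn_lgt0 // divr_gt0 // pi_gt0.
have u_ltpi : u < pi.
  rewrite /u -mulr_natr mulrAC ltr_pdivrMr // ltr_pM2l ?pi_gt0 // ltr_nat.
  by rewrite ltn_neqAle iN ltn_ord.
apply/negbTE; rewrite /cexpi eq_complex /= negb_and; apply/orP; left.
have s0 : 0 < sin u ^+ 2 by rewrite exprn_gt0 // sin_gt0_pi // u_gt0.
rewrite cos_mulr2n; apply/eqP => c1.
by have := cos2Dsin2 u; lra.
Qed.

End RootOfUnity.


Theorem lemma6p13 (R : realType) (h : nat) (h_ge1 : (1 <= h)%N) :
  let N := (2 * h + 1)%N in
  let q : R[i] := cexpi (2 * pi / N%:R) in
  (exists! act : uqops (@tpoly R[i] N), tpoly_action q act) /\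
  forall act : uqops (@tpoly R[i] N), tpoly_action q act ->
  let A := tpoly_alg act in
  [/\ haploid_alg A, commutative_alg N q A, exact_alg N q A,
      twist N q A = \1%VF & ~ in_muger_center N q (dual_rmod A)].
Proof.
move=> N q.
have N_odd : odd N by rewrite /N oddD mul2n odd_double.
have N_gt1 : (1 < N)%N by rewrite /N addn1 ltnS muln_gt0.
have q_prim : N.-primitive_root q by apply: cexpi_prim; apply: ltnW.
have N_neq0 : N%:R != 0 :> R[i] by rewrite pnatr_eq0 -lt0n ltnW.
split=> [|act act_x A]; first exact: tpoly_action_exists_unique.
split.
- exact: tpoly_haploid act_x.
- exact: tpoly_commutative act_x.
- exact: tpoly_exact act_x.
- exact: tpoly_twist act_x.
- exact: dual_not_muger act_x.
Qed.
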